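(* There is an absolute constant $\gamma>0$ such that for every integer $d\geq 2$, every connected $d$-regular vertex-transitive graph $G$ on $n$ vertices satisfies $c(G)\geq \gamma\sqrt{dn}$.
   Context: All graphs are finite and simple. $c(G)$ denotes the circumference of $G$, i.e. the length (number of edges) of a longest cycle of $G$. A graph is vertex-transitive if its automorphism group acts transitively on its vertices. *)

(* Defs.v *)
From HB Require Import structures.
From mathcomp Require Import all_boot all_order all_algebra all_fingroup.
From mathcomp Require Import reals.

Set Implicit Arguments.
Unset Strict Implicit.
Unset Printing Implicit Defensive.

(* A finite simple graph is a symmetric irreflexive relation on a finType.    *)

Section Graph.

Variables (T : finType) (e : rel T).

Definition simple_graph : Prop := symmetric e /\ irreflexive e.

(* The graph with no vertices is not connected. *)
Definition connected_graph : Prop := 0 < #|T| /\ forall x y : T, connect e x y.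

Definition regular_graph (d : nat) : Prop :=
  forall x : T, #|[set y | e x y]| = d.

Definition graph_aut : {set {perm T}} :=
  [set s : {perm T} | [forall x, forall y, e (s x) (s y) == e x y]].

Definition vertex_transitive : Prop :=
  [transitive graph_aut, on [set: T] | 'P].

(* The bound 3 <= size c matters: for an edge xy, [:: x; y] is a ucycle of e. *)
Definition graph_cycle (c : seq T) : bool := (3 <= size c) && ucycleb e c.

(* This is 0 when the graph is acyclic; cycles have distinct vertices, so no  *)
(* cycle is longer than #|T|.                                                 *)
Definition circumference : nat :=
  \max_(k < #|T|.+1 | [exists c : k.-tuple T, graph_cycle c]) k.

Lemma circumference_max (c : seq T) :
  graph_cycle c -> size c <= circumference.
Proof.
move=> cyc_c; have /and3P[_ _ uniq_c] := cyc_c.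
have lt_c : size c < #|T|.+1 by rewrite ltnS -(card_uniqP uniq_c) max_card.
apply: (@leq_bigmax_cond _ _ (fun k : 'I_#|T|.+1 => k : nat) (Ordinal lt_c)).
by apply/existsP; exists (in_tuple c).
Qed.

Lemma circumference_attained (c : seq T) :
  graph_cycle c -> exists2 c', graph_cycle c' & size c' = circumference.
Proof.
move=> cyc_c; have /and3P[_ _ uniq_c] := cyc_c.
have lt_c : size c < #|T|.+1 by rewrite ltnS -(card_uniqP uniq_c) max_card.
pose P (k : 'I_#|T|.+1) := [exists c' : k.-tuple T, graph_cycle c'].
have Pc : P (Ordinal lt_c) by apply/existsP; exists (in_tuple c).
rewrite /circumference (@bigmax_eq_arg _ _ P _ Pc).
by case: arg_maxnP => // k /existsP[c' cyc_c'] _; exists c'; rewrite ?size_tuple.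
Qed.

Lemma graph_autP (s : {perm T}) :
  reflect (forall x y, e (s x) (s y) = e x y) (s \in graph_aut).
Proof.
rewrite inE; apply: (iffP 'forall_forallP) => aut_s x y; last exact/eqP.
exact/eqP/aut_s.
Qed.

Lemma graph_aut_group_set : group_set graph_aut.
Proof.
apply/group_setP; split=> [|s t /graph_autP aut_s /graph_autP aut_t].
  by apply/graph_autP => x y; rewrite !perm1.
by apply/graph_autP => x y; rewrite !permM aut_t aut_s.
Qed.

Canonical graph_aut_group := Group graph_aut_group_set.

End Graph.

(* Main.v *)
Require Import Defs.
From HB Require Import structures.
From mathcomp Require Import all_boot all_order all_algebra all_fingroup.
From mathcomp Require Import reals.
From mathcomp Require Import boolp zify.

(* Let c be the length of a longest cycle C, n the number of vertices, t = d / 64.  A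
   vertex-transitive graph stays connected after deleting d / 2 vertices, so by Menger
   a cycle missing C is linked to it by many disjoint paths and, since C is longest,
   such a cycle is short: this gives t^2 < 2c.  For the same reason any two longest
   cycles meet.

   Two longest cycles C1 and C2 with p common vertices cut each other into p arcs each.
   A vertex v off both cycles gets the set R1 v of the arcs of C1, and R2 v of those of
   C2, that it reaches without a one-vertex bottleneck.  An arc of C1 and an arc of C2
   are never joined by two disjoint paths, hence the rectangles R1 v x R2 v' of disjoint
   pairs v, v' (equal or adjacent) are disjoint; pairs whose rectangle has at least
   i ~ t^3 / c cells are therefore met by a set Z of at most 2p^2 / i vertices.  The
   vertices with R1 and R2 both small span no long cycle, hence few edges.  So, except
   for few of them, they lie in the hull of C1 or C2, where the hull P of a cycle is a
   dense superset of size at most 3c attracting every vertex with many neighbours in it.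

   A third longest cycle C3 meets C1 and C2; walking along it from C1 to C2 it meets
   an exceptional vertex, or Z, or steps from the hull of C1 to the hull of C2.  Taking
   C2 and C3 to be random automorphic images of C1 makes all of this unlikely unless
   n^2 = O(c^3) or n i = O(c q^2) with q = O(c^2 / n), and either bound together with
   t^2 < 2c gives d n = O(c^2). *)

Set Implicit Arguments.
Unset Strict Implicit.
Unset Printing Implicit Defensive.

(** * Menger's theorem *)

(** That two longest cycles always meet yields, by averaging, only n <= c^2; the missing factor d
    has to come from connectivity. In a counterexample c^2 is small against d n, so a random
    translate of C1 meets C1 in about c^2 / n vertices, far fewer than the t vertices whose deletion
    leaves the graph connected. The common vertices therefore cannot screen a cycle off C1 and C2
    from the arcs, and it must reach many arcs of C1 or many of C2. The value of i is just large
    enough. For c^2 of order d n, p is of order d, i of order d^3 / c and Z of order c / d, so a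
    random translate meets Z about c^2 / (d n) times, a constant. The other events, meeting an
    exceptional vertex and stepping between the hulls, have expectation of order c^3 / n^2; it is to
    make this small that t^2 < 2c is used. *)

Section Menger.
Variable T : finType.
Implicit Types (r : rel T) (A B S X : {set T}) (s p : seq T) (g : T -> seq T).

Definition separates r A B S :=
  forall x p, x \in A -> path r x p -> last x p \in B -> has [in S] (x :: p).

Definition link r A B s :=
  if s is x :: p then [&& x \in A, path r x p, last x p \in B & uniq s]
  else false.

Definition linkage r A B X g :=
  (forall z, z \in X -> link r A B (g z)) /\
  (forall z z' v, z \in X -> z' \in X -> v \in g z -> v \in g z' -> z = z').

Definition del_edge r x y : rel T := [rel u v | r u v && ~~ ((u == x) && (v == y))].

Definition flip_rel r : rel T := [rel u v | r v u].

Lemma del_edge_sub r x y : subrel (del_edge r x y) r.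
Proof. by move=> u v /andP[]. Qed.

Lemma del_edge_belast r x y a p :
  path r a p -> x \notin belast a p -> path (del_edge r x y) a p.
Proof.
elim: p a => //= b p IH a /andP[rab pth]; rewrite inE negb_or => /andP[xa xp].
by rewrite {1}/del_edge /= rab (IH b pth xp) (negbTE (_ : a != x)) // eq_sym.
Qed.

Lemma del_edge_path r x y a p :
  path r a p -> y \notin p -> path (del_edge r x y) a p.
Proof.
elim: p a => //= b p IH a /andP[rab pth]; rewrite inE negb_or => /andP[yb yp].
by rewrite {1}/del_edge /= rab (IH b pth yp) (negbTE (_ : b != y)) ?andbF // eq_sym.
Qed.

Lemma flip_path r x p :
  path r x p -> path (flip_rel r) (last x p) (rev (belast x p)).
Proof. by rewrite rev_path. Qed.

Lemma rev_belast_last x p : last (last x p) (rev (belast x p)) = x.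
Proof. by case: p => //= y p; rewrite rev_cons last_rcons. Qed.

Lemma last_rev_belast x p : last x p :: rev (belast x p) = rev (x :: p).
Proof. by rewrite [x :: p]lastI rev_rcons. Qed.

Lemma head_rev z s : head z (rev s) = last z s.
Proof. by case/lastP: s => // s x; rewrite rev_rcons last_rcons. Qed.

Lemma separates_flip r A B S : separates r A B S -> separates (flip_rel r) B A S.
Proof.
move=> sep x p xB pth lA.
have := sep (last x p) (rev (belast x p)) lA (flip_path pth).
by rewrite rev_belast_last last_rev_belast has_rev; apply.
Qed.

Lemma link_flip r A B s : link r A B s -> link (flip_rel r) B A (rev s).
Proof.
case: s => // x p /and4P[xA pth lB us].
by rewrite -last_rev_belast /= lB flip_path // rev_belast_last xA
  -[_ && _]/(uniq (_ :: _)) last_rev_belast rev_uniq.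
Qed.

Lemma linkage_flip r A B X g :
  linkage r A B X g -> linkage (flip_rel r) B A X (fun z => rev (g z)).
Proof.
move=> [l1 l2]; split=> [z zX|z z' v zX z'X]; first exact/link_flip/l1.
by rewrite !mem_rev; apply: l2.
Qed.

Lemma path_first_hit r S a p :
  path r a p -> has [in S] (a :: p) ->
  exists q q', [/\ p = q ++ q', last a q \in S & ~~ has [in S] (belast a q)].
Proof.
elim: p a => [|b p IH] a; first by rewrite /= orbF => _ aS; exists [::], [::].
rewrite [path _ _ _]/= => /andP[rab pth] hS.
have [aS|aNS] := boolP (a \in S); first by exists [::], (b :: p).
have {}hS : has [in S] (b :: p) by move: hS; rewrite /= (negbTE aNS).
have [q [q' [-> lq nq]]] := IH b pth hS.
by exists (b :: q), q'; rewrite /= (negbTE aNS).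
Qed.

(* A path uses an edge leaving x only after it has visited x. *)
Lemma separates_del r A B S R x y :
  separates r A B (x |: S) -> separates (del_edge r x y) A (x |: S) R ->
  separates r A B R.
Proof.
move=> sepS sepR a p aA pth lB.
have [q [q' [ep lq nq]]] := path_first_hit pth (sepS a p aA pth lB).
have pq : path (del_edge r x y) a q.
  move: pth; rewrite ep cat_path => /andP[pth _].
  apply: del_edge_belast => //; apply: contra nq => xq.
  by apply/hasP; exists x => //; rewrite !inE eqxx.
by have := sepR a q aA pq lq; rewrite ep -cat_cons has_cat => ->.
Qed.

Lemma separates_del_tail r A B S x y :
  separates (del_edge r x y) A B S -> separates r A B (x |: S).
Proof.
move=> sepS a p aA pth lB.
have [xp|xNp] := boolP (x \in a :: p).
  by apply/hasP; exists x => //; rewrite !inE eqxx.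
have /hasP[u up uS] : has [in S] (a :: p).
  apply: (sepS a p aA _ lB); apply: del_edge_belast => //.
  by apply: contra xNp; apply: mem_belast.
by apply/hasP; exists u; rewrite // inE uS orbT.
Qed.

Lemma separates_del_head r A B S x y :
  separates (del_edge r x y) A B S -> separates r A B (y |: S).
Proof.
move=> sepS a p aA pth lB.
have [yp|yNp] := boolP (y \in a :: p).
  by apply/hasP; exists y => //; rewrite !inE eqxx.
have /hasP[u up uS] : has [in S] (a :: p).
  apply: (sepS a p aA _ lB); apply: del_edge_path => //.
  by apply: contra yNp; rewrite inE => ->; rewrite orbT.
by apply/hasP; exists u; rewrite // inE uS orbT.
Qed.

Lemma separates_ext r r' A B S : r =2 r' -> separates r A B S -> separates r' A B S.
Proof. by move=> e sepS a p aA pth; apply: sepS => //; rewrite (eq_path e). Qed.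

(** Disjoint paths have distinct ends, so once Y is no larger than X the end map is a bijection from
    X onto Y. The paths can then be indexed by their ends, as the gluing requires. *)
Lemma linkage_end r A X Y g :
  linkage r A Y X g -> #|Y| <= #|X| ->
  exists h, linkage r A Y Y h /\ forall y, y \in Y -> last y (h y) = y.
Proof.
move=> [l1 l2] cYX.
pose f z := last z (g z).
have fg z : z \in X -> f z \in g z.
  by move/l1; rewrite /f; case: (g z) => //= x p _; apply: mem_last.
have fY z : z \in X -> f z \in Y.
  by move/l1; rewrite /f; case: (g z) => // x p /and4P[].
have finj : {in X &, injective f}.
  move=> z z' zX z'X e; apply: (l2 z z' (f z)) => //; first exact: fg.
  by rewrite e; apply: fg.
have imf : f @: X = Y.
  apply/eqP; rewrite eqEcard card_in_imset // cYX andbT.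
  by apply/subsetP => _ /imsetP[z zX ->]; apply: fY.
have pre y : y \in Y -> exists2 z, z \in X & f z = y.
  by rewrite -imf => /imsetP[z zX ->]; exists z.
pose k y := odflt y [pick z in X | f z == y].
have kP y : y \in Y -> k y \in X /\ f (k y) = y.
  rewrite /k; case: pickP => [z /andP[zX /eqP]|nX /pre[z zX fz]] //=.
  by have := nX z; rewrite zX fz eqxx.
exists (fun y => g (k y)); split.
  split=> [y /kP[kX _]|y y' v /kP[kX fk] /kP[k'X fk'] vy vy']; first exact: l1.
  by rewrite -fk -fk' (l2 _ _ v kX k'X).
move=> y /kP[kX]; rewrite /f; have := l1 _ kX.
by case: (g (k y)).
Qed.

Lemma link_sub r r' A B s : subrel r r' -> link r A B s -> link r' A B s.
Proof.
by move=> sub; case: s => //= x p /and4P[-> /(sub_path sub) -> -> ->].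
Qed.

(* Göring's argument: if deleting the edge xy creates a separator S with fewer
   than k vertices, then linkages A -> x |: S and y |: S -> B can be glued. *)
Lemma linkage_glue r A B S x y g1 g2 :
  let X := x |: S in let Y := y |: S in
  r x y -> x \notin S -> y \notin S -> separates (del_edge r x y) A B S ->
  linkage (del_edge r x y) A X X g1 ->
  (forall z, z \in X -> last z (g1 z) = z) ->
  linkage (del_edge r x y) Y B Y g2 ->
  (forall z, z \in Y -> head z (g2 z) = z) ->
  exists g, linkage r A B Y g.
Proof.
move=> X Y rxy xS yS sepS [l1 d1] e1 [l2 d2] e2.
have SX z : z \in S -> z \in X by rewrite inE => ->; rewrite orbT.
have SY z : z \in S -> z \in Y by rewrite inE => ->; rewrite orbT.
have in1 z : z \in X -> z \in g1 z.
  move=> zX; have := l1 z zX; have := e1 z zX; case: (g1 z) => // a p /= ez _.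
  by rewrite -[X in X \in _]ez mem_last.
have in2 z : z \in Y -> z \in g2 z.
  move=> zY; have := l2 z zY; have := e2 z zY; case: (g2 z) => // a p /= ez _.
  by rewrite ez mem_head.
(* Following [g1 z1] up to v and then [g2 z2] gives a path from A to B without the edge xy, so it
   meets S. Each of the two paths can meet S only in its index vertex, which is one of its ends;
   this forces v to be that vertex. *)
have meet z1 z2 v : z1 \in X -> z2 \in Y -> v \in g1 z1 -> v \in g2 z2 ->
    [/\ v = z1, v = z2 & v \in S].
  move=> z1X z2Y v1 v2; have L1 := l1 _ z1X; have L2 := l2 _ z2Y.
  have E1 := e1 _ z1X; have E2 := e2 _ z2Y.
  have D1 u : u \in g1 z1 -> u \in S -> u = z1.
    by move=> u1 uS; apply: (d1 u z1 u) => //; [exact: SX|exact/in1/SX].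
  have D2 u : u \in g2 z2 -> u \in S -> u = z2.
    by move=> u2 uS; apply: (d2 u z2 u) => //; [exact: SY|exact/in2/SY].
  suff: v \in S by move=> vS; rewrite -(D1 v) // -(D2 v).
  move: E2 E1 L2 L1; case: (g1 z1) v1 D1 => // a p v1 D1; case: (g2 z2) v2 D2 => // b q v2 D2 /=.
  move=> eb la /and4P[_ pq lB uq] /and4P[aA pp _ up].
  case/splitPl: v1 pp la up D1 => p1 p1' lp1.
  rewrite cat_path last_cat => /andP[pp1 _] la up D1.
  case/splitPl: v2 pq lB uq D2 => q1 q1' lq1.
  rewrite cat_path last_cat => /andP[_ pq1] lB uq D2.
  have := sepS a (p1 ++ q1') aA; rewrite cat_path pp1 last_cat lp1 -{1 2}lq1 pq1.
  move=> /(_ isT lB) /hasP[u]; rewrite -cat_cons mem_cat => /orP[u1|u2] uS.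
    have uz : u = z1 by apply: D1 => //; rewrite -cat_cons mem_cat u1.
    suff <- : u = v by [].
    move: up; rewrite -[_ && _]/(uniq ((a :: p1) ++ p1')) cat_uniq => /and3P[_ /hasPn/(_ z1) nh _].
    case: p1' la nh {D1} => [|c p1'] la nh; first by rewrite uz -la -lp1.
    have z1t : z1 \in c :: p1' by rewrite -la /= mem_last.
    by have := nh z1t; rewrite /= -uz u1.
  have uz : u = z2 by apply: D2 => //; rewrite -cat_cons mem_cat u2 orbT.
  move: uq; rewrite -[_ && _]/(uniq ((b :: q1) ++ q1')) cat_uniq => /and3P[_ /hasPn/(_ u u2)].
  by rewrite /= uz -eb inE eqxx.
(* The path ending at x is continued through the edge xy by the path starting at y. Every z in S
   joins its own two paths, where [behead] drops the repeated z. *)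
pose phi z := if z == y then x else z.
have phiX z : z \in Y -> phi z \in X.
  by rewrite /phi !inE; case: eqP => [_ _|_ /= ->]; rewrite ?eqxx ?orbT.
have phi_inj : {in Y &, injective phi}.
  move=> z z'; rewrite /phi !inE; case: eqP => [->|_] /=; case: eqP => [-> //|_] /= zS z'S e //.
    by move: z'S; rewrite -e (negbTE xS).
  by move: zS; rewrite e (negbTE xS).
have phiS z : phi z \in S -> z \in S /\ phi z = z.
  by rewrite /phi; case: eqP => // _; rewrite (negbTE xS).
pose g z := g1 (phi z) ++ (if z == y then g2 y else behead (g2 z)).
have tl z v : v \in (if z == y then g2 y else behead (g2 z)) -> v \in g2 z.
  by case: eqP => [->|_] //; apply: mem_behead.
exists g; split=> [z zY|z z' v zY z'Y].
  have pX := phiX z zY; have := l1 _ pX; have := e1 _ pX.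
  have := l2 _ zY; have := e2 _ zY.
  have := fun v => meet (phi z) z v pX zY.
  rewrite /g; case: (g1 (phi z)) => // a p.
  rewrite /phi; case: (z =P y) => [zy|zNy] mt.
    subst z; case: (g2 y) mt => //= b q mt eb /and4P[bY pq lB uq] la /and4P[aA pp lX up].
    subst b; rewrite cat_path last_cat /= aA lB la rxy.
    rewrite (sub_path (@del_edge_sub r x y) pp) (sub_path (@del_edge_sub r x y) pq) /=.
    rewrite -[_ && _]/(uniq ((a :: p) ++ y :: q)) cat_uniq.
    rewrite (up : uniq (a :: p)) (uq : uniq (y :: q)) andbT; apply/hasPn => v vq; apply/negP => va.
    by have [vx _ vS] := mt v va vq; rewrite -vx vS in xS.
  case: (g2 z) mt => //= b q mt eb /and4P[bY pq lB uq] la /and4P[aA pp lX up].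
  subst b; rewrite cat_path last_cat aA la lB.
  rewrite (sub_path (@del_edge_sub r x y) pp) (sub_path (@del_edge_sub r x y) pq) /=.
  rewrite -[_ && _]/(uniq ((a :: p) ++ q)) cat_uniq.
  have /andP[zq ->] := uq; rewrite (up : uniq (a :: p)) andbT; apply/hasPn => v vq.
  apply/negP => va.
  have [vz _ _] : [/\ v = z, v = z & v \in S] by apply: mt => //; rewrite inE vq orbT.
  by rewrite -vz vq in zq.
rewrite /g !mem_cat => /orP[v1|/tl v2] /orP[v1'|/tl v2'].
- by apply: phi_inj => //; apply: d1 v1 v1'; exact: phiX.
- have [vp vz vS] := meet _ _ _ (phiX _ zY) z'Y v1 v2'.
  by rewrite vp in vS; have [_ e] := phiS _ vS; rewrite -e -vp.
- have [vp vz vS] := meet _ _ _ (phiX _ z'Y) zY v1' v2.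
  by rewrite vp in vS; have [_ e] := phiS _ vS; rewrite -e -vp.
- exact: d2 v2 v2'.
Qed.

Theorem menger r A B k :
  (forall S, separates r A B S -> k <= #|S|) ->
  exists X g, #|X| = k /\ linkage r A B X g.
Proof.
have [m] := ubnP #|[pred e : T * T | r e.1 e.2]|.
elim: m r A B => // m IH r A B le_m hyp.
case: (pickP [pred e : T * T | r e.1 e.2]) => [[x y] /= rxy|r0]; last first.
  have {hyp} : k <= #|A :&: B|.
    apply: hyp => a [|b p] aA; first by move=> _ aB; rewrite /= inE aA aB.
    by move=> /= /andP[rab]; have := r0 (a, b); rewrite /= rab.
  case/subset_leqif_cards: (sub0set (A :&: B)) => _ _ le_k.
  pose X := [set z in take k (enum (A :&: B))].
  have XAB z : z \in X -> z \in A :&: B.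
    by rewrite inE => /mem_take; rewrite mem_enum.
  exists X, (fun z => [:: z]); split.
    rewrite cardsE (card_uniqP _) ?take_uniq ?enum_uniq // size_take -cardE.
    by case: ltngtP le_k.
  split=> [z /XAB|z z' v _ _]; first by rewrite inE /= => /andP[-> ->].
  by rewrite !inE => /eqP <- /eqP.
have lt_m r' : (forall u v, r' u v = del_edge r x y u v) ->
    #|[pred e : T * T | r' e.1 e.2]| < m.
  move=> e; rewrite -ltnS; apply: leq_trans le_m; rewrite ltnS.
  apply: proper_card; apply/properP; split.
    by apply/subsetP => -[u v]; rewrite !inE /= e => /andP[].
  by exists (x, y); rewrite !inE /= ?e /del_edge /= ?rxy ?eqxx.
have lt_m' r' : (forall u v, r' u v = del_edge r x y v u) ->
    #|[pred e : T * T | r' e.1 e.2]| < m.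
  move=> e; rewrite -[X in X < _](card_imset _ (inv_inj (@swap_pairK T T))).
  apply: leq_ltn_trans (lt_m (del_edge r x y) (fun _ _ => erefl)).
  by apply: subset_leq_card; apply/subsetP => _ /imsetP[[u v] + ->]; rewrite !inE /= e.
have [sepdel|] := boolp.EM (forall S, separates (del_edge r x y) A B S -> k <= #|S|).
  have [X [g [cX [l1 l2]]]] := IH _ _ _ (lt_m (del_edge r x y) (fun _ _ => erefl)) sepdel.
  exists X, g; split=> //; split=> // z zX.
  exact: link_sub (@del_edge_sub r x y) (l1 z zX).
move/boolp.existsNP => [S /boolp.not_implyP[sepS /negP]]; rewrite -ltnNge => ltS.
(* Both [x |: S] and [y |: S] separate A from B in r, while S has fewer than k vertices. Hence both
   have exactly k vertices, and neither x nor y lies in S. *)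
have kx := hyp _ (separates_del_tail sepS).
have ky := hyp _ (separates_del_head sepS).
have xS : x \notin S by apply/negP => xS; move: kx; rewrite cardsU1 xS; lia.
have yS : y \notin S by apply/negP => yS; move: ky; rewrite cardsU1 yS; lia.
have ekx : #|x |: S| = k by apply/eqP; rewrite eqn_leq kx cardsU1 xS andbT; lia.
have eky : #|y |: S| = k by apply/eqP; rewrite eqn_leq ky cardsU1 yS andbT; lia.
have [X1 [g1 [cX1 L1]]] : exists X g, #|X| = k /\ linkage (del_edge r x y) A (x |: S) X g.
  apply: IH (lt_m (del_edge r x y) (fun _ _ => erefl)) _ => R sepR.
  exact/hyp/(separates_del (separates_del_tail sepS) sepR).
have [|h1 [Lh1 e1]] := linkage_end L1; first by rewrite ekx cX1.
have [X2 [g2 [cX2 L2]]] : exists X g, #|X| = k /\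
    linkage (flip_rel (del_edge r x y)) B (y |: S) X g.
  apply: IH (lt_m' (flip_rel (del_edge r x y)) (fun _ _ => erefl)) _ => R sepR.
  apply: hyp; have sepY := separates_flip (separates_del_head sepS).
  suff : separates (flip_rel r) B A R by move/separates_flip.
  apply: (separates_del sepY (x := y) (y := x)).
  apply: separates_ext sepR => u v; rewrite /= /flip_rel /del_edge /=.
  by rewrite [(v == x) && _]andbC.
have [|h2 [Lh2 e2]] := linkage_end L2; first by rewrite eky cX2.
have [g Lg] := linkage_glue rxy xS yS sepS Lh1 e1 (linkage_flip Lh2)
  (fun z zY => etrans (head_rev z (h2 z)) (e2 z zY)).
by exists (y |: S), g.
Qed.

End Menger.

(* lia treats sizes at the two convertible carriers of a finType as distinct,
   and is very slow on the boolean hypotheses that are cleared here. *)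
Ltac slia := repeat match goal with
  | H : ?P |- _ => lazymatch P with
      | is_true (leq _ _) => fail
      | @eq nat _ _ => fail
      | _ => clear H
      end
  end;
  repeat match goal with
  | H : context [@size (Equality.sort (fintype_Finite__to__eqtype_Equality ?U)) ?s] |- _ =>
    change (@size (Equality.sort (fintype_Finite__to__eqtype_Equality U)) s)
      with (@size (Finite.sort U) s) in H
  | |- context [@size (Equality.sort (fintype_Finite__to__eqtype_Equality ?U)) ?s] =>
    change (@size (Equality.sort (fintype_Finite__to__eqtype_Equality U)) s)
      with (@size (Finite.sort U) s)
  end; lia.

(** * Spaced positions along a sequence *)

Section Spaced.
Variable T : finType.

Lemma spaced_spread (X : {set T}) (f : T -> nat) g r :
  {in X &, injective f} ->
  {in X &, forall x y, f x < f y -> f x + g <= f y} -> #|X| = r.+1 ->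
  exists x y, [/\ x \in X, y \in X & f x + r * g <= f y].
Proof.
elim: r X => [|r IH] X finj sp cX.
  have [x xX] : exists x, x \in X by apply/card_gt0P; rewrite cX.
  by exists x, x; rewrite mul0n addn0.
have [x0 x0X] : exists x, x \in X by apply/card_gt0P; rewrite cX.
have [y yX0 ymax] := arg_maxnP f x0X; have yX : y \in X := yX0.
have sX : {subset X :\ y <= X} by move=> z /setD1P[].
have cX' : #|X :\ y| = r.+1 by move: cX; rewrite (cardsD1 y X) yX => -[].
have [||x [y' [xX y'X le]]] := IH (X :\ y) _ _ cX'.
- by move=> a b /sX aX /sX bX; apply: finj.
- by move=> a b /sX aX /sX bX; apply: sp.
exists x, y; split=> //; first exact: sX.
have lt : f y' < f y.
  rewrite ltn_neqAle; apply/andP; split; last by apply: ymax; apply: sX.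
  apply/negP => /eqP /(finj _ _ (sX _ y'X) yX) yy.
  by move: y'X; rewrite yy setD11.
by have := sp _ _ (sX _ y'X) yX lt; lia.
Qed.

Lemma index_split (C : seq T) x y : x \in C -> y \in C -> index x C < index y C ->
  exists s0 s1 s2, [/\ C = s0 ++ x :: s1 ++ y :: s2, index x C = size s0
                     & index y C = size s0 + (size s1).+1].
Proof.
move=> xC yC lt.
have lx : index x C < size C by rewrite index_mem.
have ly : index y C < size C by rewrite index_mem.
exists (take (index x C) C), (drop (index x C).+1 (take (index y C) C)),
  (drop (index y C).+1 C); split.
- rewrite -[LHS](cat_take_drop (index x C)); congr (_ ++ _).
  rewrite (drop_nth x) // nth_index //; congr (_ :: _).
  have le : (index x C).+1 <= index y C by [].
  have -> : drop (index x C).+1 C = drop (index x C).+1 (take (index y C) C)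
      ++ drop (index y C) C.
    by rewrite -(subnK le) -take_drop -drop_drop cat_take_drop.
  by rewrite (drop_nth x ly) nth_index.
- by rewrite size_takel // ltnW.
- by rewrite size_drop !size_takel ?(ltnW lx) ?(ltnW ly) //; lia.
Qed.

End Spaced.

(** * Disjoint links between two vertex sets *)

Section Links.
Variables (T : finType) (e : rel T).
Hypotheses (e_sym : symmetric e) (e_irr : irreflexive e).
Implicit Types (A B S W X Y : {set T}) (p q s C O : seq T).

Definition rin W : rel T := [rel u v | [&& u \in W, v \in W & e u v]].

Lemma rin_sym W : symmetric (rin W).
Proof. by move=> u v; rewrite /rin /= e_sym andbCA. Qed.

Lemma rin_sub W W' : W \subset W' -> subrel (rin W) (rin W').
Proof. by move=> /subsetP sub u v /and3P[/sub uW /sub vW euv]; apply/and3P. Qed.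

Lemma connect_rin_sub W W' x y : W \subset W' ->
  connect (rin W) x y -> connect (rin W') x y.
Proof. by move=> sub; apply: connect_sub => u v /(rin_sub sub)/connect1. Qed.

(** Edges neither leave B nor enter A, so every path from A to B has its interior off both sets. The
    relation is not symmetric, which is why [menger] is stated for arbitrary relations. *)
Definition rtrim W A B : rel T := [rel u v | [&& rin W u v, u \notin B & v \notin A]].

Lemma rtrim_path W A B a p : path (rin W) a p -> ~~ has [in B] (belast a p) ->
  ~~ has [in A] p -> path (rtrim W A B) a p.
Proof.
elim: p a => //= b p IH a /andP[rab pth]; rewrite !negb_or => /andP[aB nB] /andP[bA nA].
by rewrite IH // /rtrim /= rab aB bA.
Qed.

Lemma trim W A B a p : path (rin W) a p -> a \in A -> last a p \in B ->
  exists a' p', [/\ a' \in A, last a' p' \in B & path (rtrim W A B) a' p'].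
Proof.
have [m] := ubnP (size p); elim: m a p => // m IH a p /ltnSE le pth aA lB.
have [/hasP[a' a'p a'A]|nA] := boolP (has [in A] p).
  case/splitPr: a'p pth lB le => p1 p2; rewrite cat_path last_cat /= size_cat /=.
  by move=> /and3P[_ _ pth] lB le; apply: IH pth a'A lB; lia.
have [/hasP[b bp bB]|nB] := boolP (has [in B] (belast a p)); last first.
  by exists a, p; split=> //; apply: rtrim_path.
case/lastP: p => [|p z] in pth lB le nA bp *; first by [].
rewrite belast_rcons in bp; case/splitPl: bp pth le => p1 p2 lp1.
rewrite rcons_cat cat_path lp1 => /andP[pth _]; rewrite size_cat size_rcons => le.
by apply: IH pth aA _; rewrite ?lp1 //; lia.
Qed.

(** A path is recorded by its end z in B, its start [u z] and its interior [m z]. As A and B are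
    disjoint it has at least one edge, so these data describe it. *)
Lemma menger_links W A B k : [disjoint A & B] ->
  (forall S, #|S| < k -> exists a b,
     [/\ a \in A :\: S, b \in B :\: S & connect (rin (W :\: S)) a b]) ->
  exists X (u : T -> T) (m : T -> seq T),
  [/\ X \subset B, #|X| = k,
   forall z, z \in X -> [/\ u z \in A, path e (u z) (rcons (m z) z), uniq (m z)
     & {subset m z <= W :\: (A :|: B)}]
   & forall z z', z \in X -> z' \in X -> z != z' ->
       u z != u z' /\ [disjoint m z & m z']].
Proof.
move=> dAB conn.
have [S sepS|X [g [cX [l1 l2]]]] := @menger T (rtrim W A B) A B k.
  rewrite leqNgt; apply/negP => /conn[a [b [/setDP[aA aS] /setDP[bB bS]]]].
  case/connectP => p pth lp.
  have := @trim _ A B _ _ pth aA; rewrite -lp => /(_ bB)[a' [p' [a'A l'B pth']]].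
  have := sepS a' p' a'A; rewrite (sub_path _ pth') => [/(_ isT l'B)|]; last first.
    move=> v w /and3P[/rin_sub + vB wA]; move=> /(_ _ (subsetDl W S)) /= vw.
    by rewrite /rtrim /= vw vB wA.
  have nin : forall v w, rtrim (W :\: S) A B v w -> (v \notin S) && (w \notin S).
    by move=> v w /and3P[/and3P[/setDP[_ ->] /setDP[_ ->] _] _ _].
  case: p' l'B pth' => [|w p'] l'B pth'.
    by move/pred0P/(_ a'): dAB; rewrite /= a'A l'B.
  move=> hS; suff: ~~ has [in S] (a' :: w :: p') by rewrite hS.
  rewrite -all_predC; have {l'B a'A hS} := pth'.
  elim: p' a' w pth' => [|w' p' IH] a' w /=; first by rewrite andbT => /nin/andP[-> ->].
  move=> /andP[/nin/andP[-> _] pth'] _ /=; exact: IH.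
pose f z := last z (g z).
pose u' z := head z (g z).
pose m' z := behead (behead (belast z (g z))).
have gP z : z \in X -> [/\ g z = u' z :: rcons (m' z) (f z), u' z \in A /\ f z \in B,
    path e (u' z) (rcons (m' z) (f z)), uniq (m' z)
    & {subset m' z <= W :\: (A :|: B)}].
  move/l1; rewrite /f /u' /m'; case: (g z) => //= x p /and4P[xA pth lB /andP[_ up]].
  case/lastP: p => [|p y] in pth lB up *.
    by move/pred0P/(_ x): dAB; rewrite /= xA lB.
  rewrite belast_rcons last_rcons /= in lB *; split=> //.
  - by apply: sub_path pth => v w /and3P[/and3P[]].
  - by move: up; rewrite rcons_uniq => /andP[].
  move=> v vp; case/splitPr: vp pth {up} => p1 p2; rewrite rcons_cat cat_path /=.
  case E: (rcons p2 y) => [|w p3]; first by case: (p2) E.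
  move=> /and4P[_ /and3P[/and3P[_ vW _] _ vA] /and3P[_ vB _] _].
  by rewrite !inE negb_or vA vB vW.
have finj : {in X &, injective f}.
  move=> z z' zX z'X efz; apply: (l2 z z' (f z)) => //.
    by have [-> _ _ _ _] := gP z zX; rewrite inE mem_rcons mem_head orbT.
  by have [-> _ _ _ _] := gP z' z'X; rewrite efz inE mem_rcons mem_head orbT.
pose k' y := odflt y [pick z in X | f z == y].
have k'P z : z \in X -> k' (f z) = z.
  rewrite /k' => zX; case: pickP => [z' /andP[z'X /eqP/(finj _ _ z'X zX)]|/(_ z)] //=.
  by rewrite zX eqxx.
exists (f @: X), (u' \o k'), (m' \o k'); split.
- by apply/subsetP => _ /imsetP[z zX ->]; have [_ []] := gP z zX.
- by rewrite card_in_imset.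
- by move=> _ /imsetP[z zX ->] /=; rewrite k'P //; have [_ [uA _] pz uz sz] := gP z zX.
move=> _ _ /imsetP[z zX ->] /imsetP[z' z'X ->] /=; rewrite !k'P // => nff'.
have nzz' : z <> z' by move=> zz'; rewrite zz' eqxx in nff'.
have [gz _ _ _ _] := gP z zX; have [gz' _ _ _ _] := gP z' z'X; split.
  apply/negP => /eqP uu; apply/nzz'/(l2 _ _ (u' z)) => //.
    by rewrite gz mem_head.
  by rewrite gz' uu mem_head.
apply/pred0P => v /=; apply/negP => /andP[vm vm']; apply/nzz'/(l2 _ _ v) => //.
  by rewrite gz inE mem_rcons inE vm !orbT.
by rewrite gz' inE mem_rcons inE vm' !orbT.
Qed.

End Links.

(** * Cycles off a longest cycle *)

Section LongestCycle.
Variables (T : finType) (e : rel T).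
Hypotheses (e_sym : symmetric e) (e_irr : irreflexive e).
Implicit Types (A B S W X Y : {set T}) (p q s C O : seq T).

Lemma path_flip x q y : path e x (rcons q y) -> path e y (rcons (rev q) x).
Proof.
have := rev_path (fun u v => e v u) x (rcons q y).
rewrite last_rcons belast_rcons rev_cons => <-.
by rewrite (eq_path (e' := e)) // => u v; rewrite e_sym.
Qed.

Definition longest C := graph_cycle e C && (size C == circumference e).

Lemma longest_cycle C : longest C -> [/\ 3 <= size C, path.cycle e C & uniq C].
Proof. by case/andP => /and3P[]. Qed.

Lemma longest_max C C' : longest C -> 3 <= size C' -> path.cycle e C' -> uniq C' ->
  size C' <= size C.
Proof.
by case/andP=> _ /eqP -> h3 cy un; apply: circumference_max; rewrite /graph_cycle /ucycleb h3 cy.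
Qed.

Lemma longest_rot n C : longest C -> longest (rot n C).
Proof.
by rewrite /longest /graph_cycle /ucycleb size_rot rot_cycle rot_uniq.
Qed.

(** Replacing s1 by q gives another cycle, which cannot be longer than C. *)
Lemma detour1 C s1 s2 x y q : longest C -> C = x :: s1 ++ y :: s2 ->
  path e x (rcons q y) -> uniq q -> {in q, forall v, v \notin C} ->
  size q <= size s1.
Proof.
move=> lC eC pq uq dq; have [h3 cC uC] := longest_cycle lC.
case: (posnP (size q)) => [->//|q0].
(* A nonempty q guarantees the three vertices that a cycle must have. *)
suff /andP[c1 u1] : path.cycle e (x :: q ++ y :: s2) && uniq (x :: q ++ y :: s2).
  have := longest_max lC _ c1 u1; rewrite eC /= !size_cat /=; slia.
move: cC uC; rewrite eC /= !rcons_cat !rcons_cons !cat_path /= => /and3P[_ _ ->].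
move: (pq); rewrite rcons_path => /andP[-> ->] /=.
rewrite !mem_cat !cat_uniq uq !inE !negb_or /= => /andP[/and3P[xs1 xy xs2]].
move=> /and4P[us1 /andP[ys1 ns1] ys2 us2].
have xq : x \notin q by apply/negP => /dq; rewrite eC mem_head.
have yq : y \notin q by apply/negP => /dq; rewrite eC !inE mem_cat mem_head !orbT.
rewrite xq xy xs2 yq ys2 us2 /= andbT; apply/hasPn => v vs2; apply/negP => /dq.
by rewrite eC !inE mem_cat inE vs2 !orbT.
Qed.

Lemma detour C s0 s1 s2 x y q : longest C -> C = s0 ++ x :: s1 ++ y :: s2 ->
  path e x (rcons q y) -> uniq q -> {in q, forall v, v \notin C} ->
  size q <= size s1 /\ size q <= size s2 + size s0.
Proof.
move=> lC eC pq uq dq.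
have rC n v : (v \notin rot n C) = (v \notin C) by rewrite mem_rot.
have e1 : rot (size s0) C = x :: s1 ++ y :: (s2 ++ s0).
  by rewrite eC rot_size_cat /= -catA.
have e2 : rot (size (s0 ++ x :: s1)) C = y :: (s2 ++ s0) ++ x :: s1.
  have -> : C = (s0 ++ x :: s1) ++ y :: s2 by rewrite eC -catA.
  by rewrite rot_size_cat /= -catA.
split.
  by apply: detour1 (longest_rot _ lC) e1 pq uq _ => v /dq; rewrite rC.
rewrite -size_cat -(size_rev q).
apply: detour1 (longest_rot _ lC) e2 (path_flip pq) _ _; first by rewrite rev_uniq.
by move=> v; rewrite mem_rev => /dq; rewrite rC.
Qed.

Lemma detour_index C x y q : longest C -> x \in C -> y \in C -> index x C < index y C ->
  path e x (rcons q y) -> uniq q -> {in q, forall v, v \notin C} ->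
  index x C + (size q).+1 <= index y C.
Proof.
move=> lC xC yC lt pq uq dq.
have [s0 [s1 [s2 [eC -> ->]]]] := index_split xC yC lt.
by have [le1 _] := detour lC eC pq uq dq; rewrite leq_add2l ltnS.
Qed.

Lemma cycle_arc O x y : path.cycle e O -> uniq O -> x \in O -> y \in O -> x != y ->
  exists2 q, path e x (rcons q y) &
    [/\ uniq q, {subset q <= O}, x \notin q, y \notin q & size O <= 2 * size q + 2].
Proof.
move=> cO uO xO yO nxy.
have [i p1 p2 _ _ er] := rot_to_arc uO xO yO nxy.
move: cO uO; rewrite -(rot_cycle i) -(rot_uniq i) er /=.
rewrite rcons_cat /= cat_path /= => /and3P[px pl py].
rewrite mem_cat cat_uniq !inE !negb_or /= => /andP[/and3P[xp1 _ xp2]].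
move=> /and3P[up1 /andP[yp1 _] /andP[yp2 up2]].
have eO v : (v \in O) = (v \in x :: p1 ++ y :: p2) by rewrite -er mem_rot.
have sO : size O = size p1 + size p2 + 2.
  by rewrite -(size_rot i) er /= size_cat /=; slia.
have [le|lt] := leqP (size p2) (size p1).
  exists p1; first by rewrite rcons_path px.
  split=> //; last by slia.
  by move=> v vp; rewrite eO inE mem_cat vp orbT.
exists (rev p2); first exact: path_flip.
split; rewrite ?rev_uniq ?mem_rev ?size_rev //; last by slia.
by move=> v; rewrite mem_rev => vp; rewrite eO !inE mem_cat inE vp !orbT.
Qed.

Lemma path_join x1 x2 u1 u2 m1 m2 q :
  path e u1 (rcons m1 x1) -> path e u2 (rcons m2 x2) -> path e u1 (rcons q u2) ->
  path e x1 (rcons (rev m1 ++ u1 :: q ++ u2 :: m2) x2).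
Proof.
move=> /path_flip + p2; rewrite !rcons_path => /andP[p1 l1] /andP[pq lq].
move: p2; rewrite rcons_path => /andP[p2 l2].
by rewrite cat_path p1 /= l1 cat_path pq /= lq p2 /= !(last_cat, last_cons).
Qed.

Lemma path_join_uniq u1 u2 m1 m2 q A :
  uniq m1 -> uniq m2 -> uniq q -> [disjoint m1 & m2] ->
  u1 != u2 -> u1 \notin q -> u2 \notin q ->
  {in m1, forall v, v \notin A} -> {in m2, forall v, v \notin A} ->
  u1 \in A -> u2 \in A -> {subset q <= A} ->
  uniq (rev m1 ++ u1 :: q ++ u2 :: m2).
Proof.
move=> um1 um2 uq d n12 n1 n2 a1 a2 u1A u2A qA.
have nu1 m : {in m, forall v, v \notin A} -> u1 \notin m.
  by move=> a; apply/negP => /a; rewrite u1A.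
have nu2 m : {in m, forall v, v \notin A} -> u2 \notin m.
  by move=> a; apply/negP => /a; rewrite u2A.
rewrite cat_uniq rev_uniq um1 /= negb_or mem_rev nu1 //= mem_cat inE !negb_or.
rewrite n1 n12 nu1 //= cat_uniq uq /= um2 nu2 // negb_or n2 !andbT /=.
rewrite has_cat negb_or /= negb_or mem_rev nu2 //= -andbA; apply/and3P; split.
- by apply/hasPn => v /qA vA; rewrite mem_rev; apply/negP => /a1; rewrite vA.
- by apply/hasPn => v vm2; rewrite mem_rev (disjointFl d).
- by apply/hasPn => v /a2 vA; apply: contra vA => /qA.
Qed.

Lemma bridge O x1 x2 u1 u2 m1 m2 : path.cycle e O -> uniq O -> u1 \in O -> u2 \in O ->
  u1 != u2 -> path e u1 (rcons m1 x1) -> path e u2 (rcons m2 x2) ->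
  uniq m1 -> uniq m2 -> [disjoint m1 & m2] ->
  {in m1, forall v, v \notin O} -> {in m2, forall v, v \notin O} ->
  exists2 q, path e x1 (rcons q x2) &
   [/\ uniq q, size O + 2 <= 2 * size q
     & forall v, v \in q -> [|| v \in O, v \in m1 | v \in m2]].
Proof.
move=> cO uO u1O u2O n12 p1 p2 um1 um2 d a1 a2.
have [q pq [uq qO n1 n2 sq]] := cycle_arc cO uO u1O u2O n12.
exists (rev m1 ++ u1 :: q ++ u2 :: m2); first exact: path_join.
split; last 1 first.
- move=> v; rewrite mem_cat inE mem_cat inE mem_rev.
  by case/or3P=> [->|/eqP->|/or3P[/qO->|/eqP->|->]]; rewrite ?u1O ?u2O ?orbT.
- by apply: (@path_join_uniq _ _ _ _ _ [set v in O]) => // [v /a1|v /a2|||v /qO];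
    rewrite inE.
- by rewrite size_cat /= size_cat /= size_rev; slia.
Qed.

(** This is (t + 1)-connectivity, without the usual lower bound on the number of vertices. *)
Definition avoids_separators t :=
  forall S x y, #|S| <= t -> x \notin S -> y \notin S -> connect (rin e (~: S)) x y.

Definition hit C C' := #|[set x in C] :&: [set x in C']|.

Lemma card_seq_set C : uniq C -> #|[set x in C]| = size C.
Proof. by move=> uC; rewrite cardsE (card_uniqP uC). Qed.

Lemma index_inj_in C (X : {set T}) : {subset X <= C} -> {in X &, injective (index^~ C)}.
Proof.
by move=> sX x y /sX xC /sX yC exy; rewrite -(nth_index x xC) exy nth_index.
Qed.

Definition links O C (X : {set T}) (u : T -> T) (m : T -> seq T) :=
  [/\ {subset X <= C},
   forall z, z \in X -> [/\ u z \in O, path e (u z) (rcons (m z) z), uniq (m z)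
     & {in m z, forall v, (v \notin O) && (v \notin C)}]
   & forall z z', z \in X -> z' \in X -> z != z' ->
       u z != u z' /\ [disjoint m z & m z']].

Lemma links_bridge O C X u m x y : path.cycle e O -> uniq O ->
  {in O, forall v, v \notin C} -> links O C X u m -> x \in X -> y \in X -> x != y ->
  exists2 q, path e x (rcons q y) &
    [/\ uniq q, size O + 2 <= 2 * size q, {in q, forall v, v \notin C}
      & forall v, v \in q -> [|| v \in O, v \in m x | v \in m y]].
Proof.
move=> cO uO dO [XC hl hd] xX yX nxy.
have [nu dm] := hd x y xX yX nxy.
have [ux px umx mx] := hl x xX; have [uy py umy my] := hl y yX.
have [||q pq [uq sq qs]] := bridge cO uO ux uy nu px py umx umy dm.
- by move=> v /mx/andP[].
- by move=> v /my/andP[].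
by exists q => //; split=> // v /qs/or3P[/dO|/mx/andP[]|/my/andP[]].
Qed.

(** Two links joined along the longer side of O form a detour q with [size O + 2 <= 2 * size q].
    Since C is longest, their ends are at least [size q + 1] apart on C, that is, at least half of
    [size O + 4]. *)
Lemma links_spread O C X u m r : longest C -> path.cycle e O -> uniq O ->
  {in O, forall v, v \notin C} -> links O C X u m -> #|X| = r.+1 ->
  exists x y, [/\ x \in X, y \in X & index x C + r * uphalf (size O + 4) <= index y C].
Proof.
move=> lC cO uO dO lk cX; have [XC _ _] := lk.
apply: (spaced_spread (index_inj_in XC) _ cX) => x y xX yX lt.
have nxy : x != y by apply: contraTneq lt => ->; rewrite ltnn.
have [q pq [uq sq dq _]] := links_bridge cO uO dO lk xX yX nxy.
by have := detour_index lC (XC _ xX) (XC _ yX) lt pq uq dq; slia.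
Qed.

Lemma cycle_links t C O : avoids_separators t -> longest C -> t < size O -> t < size C ->
  uniq O -> {in O, forall v, v \notin C} ->
  exists X u m, #|X| = t.+1 /\ links O C X u m.
Proof.
move=> av lC tO tC uO dO; have [h3 cC uC] := longest_cycle lC.
have dOC : [disjoint [set x in O] & [set x in C]].
  by apply/pred0P => v /=; rewrite !inE; apply/negP => /andP[/dO/negP].
have ex S (D : {set T}) : t < #|D| -> #|S| < t.+1 -> exists a, a \in D :\: S.
  move=> tD tS; apply/set0Pn; rewrite -card_gt0.
  by have := cardsID S D; have := subset_leq_card (subsetIr D S); slia.
have [S tS|X [u [m [XB cX h1 h2]]]] :=
    @menger_links T e setT [set x in O] [set x in C] t.+1 dOC.
  have [a aA] := ex S [set x in O] ltac:(by rewrite card_seq_set) tS.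
  have [b bB] := ex S [set x in C] ltac:(by rewrite card_seq_set) tS.
  exists a, b; split=> //; rewrite setTD; apply: av => //.
    by move: aA; rewrite inE => /andP[].
  by move: bB; rewrite inE => /andP[].
exists X, u, m; split=> //; split=> // [x /(subsetP XB)|z /h1[h4 h5 h6 h7]].
  by rewrite inE.
split=> // [|v /h7]; first by move: h4; rewrite inE.
by rewrite !inE negb_or andbT.
Qed.

(** The t + 1 link ends leave t gaps along C, each of at least half of [size O + 4]. *)
Lemma disjoint_cycle_bound t C O : avoids_separators t -> longest C -> 1 < t ->
  t < size O -> path.cycle e O -> uniq O -> {in O, forall v, v \notin C} ->
  t * (size O + 4) < 2 * size C.
Proof.
move=> av lC t1 tO cO uO dO; have [h3 cC uC] := longest_cycle lC.
have tC : t < size C := leq_trans tO (longest_max lC (leq_trans (t1 : 2 < t.+1) tO) cO uO).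
have [X [u [m [cX lk]]]] := cycle_links av lC tO tC uO dO.
have [XC _ _] := lk.
have [x [y [xX yX le]]] := links_spread lC cO uO dO lk cX.
have lt : index y C < size C by rewrite index_mem; apply: XC.
have le2 : size O + 4 <= 2 * uphalf (size O + 4) by slia.
have := leq_mul (leqnn t) le2; move: le lt; rewrite mulnCA; slia.
Qed.

(** Two disjoint links already give a detour with more than half as many vertices as O. Both sides
    of C between the link ends would have to be at least that long, and together they exceed C. *)
Lemma longest_cycles_meet C O : avoids_separators 1 -> longest C -> longest O ->
  exists2 v, v \in O & v \in C.
Proof.
move=> av lC lO; have [h3 cC uC] := longest_cycle lC.
have [h3' cO uO] := longest_cycle lO.
have eCO : size C = size O by case/andP: lC => _ /eqP ->; case/andP: lO => _ /eqP ->.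
have [/hasP[v vO vC]|/hasPn dO] := boolP (has [in C] O); first by exists v.
have [X [u [m [cX lk]]]] := cycle_links av lC (ltnW h3') (ltnW h3) uO dO.
have [XC _ _] := lk.
have [x [y [xX yX lt]]] : exists x y, [/\ x \in X, y \in X & index x C < index y C].
  have /cards2P[x [y [nxy eX]]] : #|X| == 2 by rewrite cX.
  have [xX yX] : x \in X /\ y \in X by rewrite eX !inE !eqxx orbT.
  have : index x C != index y C.
    by apply: contra nxy => /eqP/(index_inj_in XC xX yX) ->.
  by rewrite neq_ltn => /orP[lt|lt]; [exists x, y|exists y, x]; split.
have nxy : x != y by apply: contraTneq lt => ->; rewrite ltnn.
have [q pq [uq sq dq _]] := links_bridge cO uO dO lk xX yX nxy.
have [s0 [s1 [s2 [eC _ _]]]] := index_split (XC _ xX) (XC _ yX) lt.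
have [le1 le2] := detour lC eC pq uq dq.
have : size C = size s0 + size s1 + size s2 + 2.
  by rewrite eC !size_cat /= size_cat /=; slia.
slia.
Qed.

Definition nbrs x : {set T} := [set y | e x y].
Definition deg_in Y x := #|nbrs x :&: Y|.
(** Ordered pairs are counted, so an edge inside X contributes 2 to [edges X X]. *)
Definition edges X Y := \sum_(x in X) deg_in Y x.

(** A path in H that cannot be extended at its front x contains all neighbours of x in H. Closing it
    at the furthest of them encloses x and more than t neighbours. *)
Lemma long_cycle_min_degree (H : {set T}) t : 0 < t -> H != set0 ->
  {in H, forall v, t < deg_in H v} ->
  exists O, [/\ t.+1 < size O, path.cycle e O, uniq O & {subset O <= H}].
Proof.
move=> t0 /set0Pn[x0 x0H] dH.
have [x [p [pth up sH nx]]] : exists x p, [/\ path e x p, uniq (x :: p),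
    {subset x :: p <= H} & nbrs x :&: H \subset p].
  have [m] := ubnP (#|T| - size [::x0]).
  have : path e x0 [::] && uniq [:: x0] by [].
  have : {subset [:: x0] <= H} by move=> v; rewrite inE => /eqP ->.
  elim: m x0 {x0H} [::] => // m IH x p sH /andP[pth up] le.
  have [|/subsetPn[y]] := boolP (nbrs x :&: H \subset p); first by exists x, p.
  rewrite !inE => /andP[exy yH] yp.
  have uy : uniq (y :: x :: p).
    rewrite cons_uniq up inE negb_or yp !andbT.
    by apply: contraTneq exy => ->; rewrite e_irr.
  apply: (IH y (x :: p)).
  - by move=> v; rewrite inE => /orP[/eqP ->|/sH].
  - by rewrite uy /= e_sym exy pth.
  - have := max_card [in y :: x :: p]; rewrite (card_uniqP uy) /=.
    by move: le; rewrite /=; slia.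
have dx := dH x (sH _ (mem_head _ _)).
have [y0 y0N] : exists y, y \in nbrs x :&: H.
  by apply/card_gt0P; apply: leq_ltn_trans dx.
have [y yN' ymax] := arg_maxnP (fun v => index v p) y0N.
have yN : y \in nbrs x :&: H := yN'.
have yp := subsetP nx _ yN.
have exy : e x y by move: yN; rewrite !inE => /andP[].
case/splitPr: yp pth up sH nx ymax => p1 p2; rewrite cat_path /=.
move=> /andP[pth1 /andP[ly _]] up sH nx ymax.
have := up : uniq ((x :: p1) ++ y :: p2); rewrite cat_uniq cons_uniq => /and3P[+ hs _].
move=> /andP[xp1 up1].
have /hasPn/(_ y (mem_head _ _)) := hs; rewrite /= inE negb_or => /andP[_ yp1'].
exists (x :: rcons p1 y); split.
- rewrite /= size_rcons ltnS; apply: leq_trans dx _.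
  have : nbrs x :&: H \subset rcons p1 y.
    apply/subsetP => v vN; have le := ymax v vN.
    have [vp1|vp1] := boolP (v \in p1); first by rewrite mem_rcons inE vp1 orbT.
    have [->|nvy] := eqVneq v y; first by rewrite mem_rcons mem_head.
    move: le; rewrite /= !index_cat (negbTE vp1) (negbTE yp1') /= eqxx.
    by rewrite eq_sym (negbTE nvy) addn0 addnS ltnNge leq_addr.
  move/subset_leq_card/leq_trans; apply.
  by rewrite (leq_trans (card_size _)) // size_rcons.
- by rewrite /= rcons_path rcons_path pth1 ly last_rcons e_sym.
- rewrite /= rcons_uniq mem_rcons inE negb_or xp1 up1 yp1' !andbT.
  by apply: contraTneq exy => ->; rewrite e_irr.
- move=> v vO; apply: sH; move: vO.
  rewrite !inE mem_rcons mem_cat !inE => /or3P[->|->|->] //; rewrite ?orbT //.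
Qed.

Lemma edges_setD1 (H : {set T}) v : v \in H ->
  edges H H = edges (H :\ v) (H :\ v) + 2 * deg_in H v.
Proof.
move=> vH; rewrite /edges (big_setD1 v vH) /=.
have E x : x \in H -> deg_in H x = deg_in (H :\ v) x + e x v.
  move=> xH; rewrite /deg_in (cardsD1 v (nbrs x :&: H)) !inE vH andbT addnC.
  by congr (#|pred_of_set _| + _); apply/setP => y; rewrite !inE; case: (y == v); rewrite ?andbF.
rewrite (eq_bigr (fun x => deg_in (H :\ v) x + e x v)); last first.
  by move=> x /setD1P[_ /E].
rewrite big_split /=.
suff -> : \sum_(x in H :\ v) e x v = deg_in H v by slia.
rewrite -big_mkcondr /= sum1_card; apply: eq_card => x; rewrite !inE e_sym.
by rewrite unfold_in !inE; case: eqP => [->|_]; rewrite /= ?e_irr ?andbF // andbC.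
Qed.

(** Deleting a vertex of degree at most t removes at most 2t ordered pairs, so the density
    hypothesis survives until every degree exceeds t. *)
Lemma long_cycle_dense (H : {set T}) t : 0 < t -> H != set0 ->
  2 * t * #|H| <= edges H H ->
  exists O, [/\ t.+1 < size O, path.cycle e O, uniq O & {subset O <= H}].
Proof.
move=> t0; have [m] := ubnP #|H|; elim: m H => // m IH H /ltnSE le H0 dense.
have [/existsP[v /andP[vH dv]]|/existsPn hd] := boolP [exists v, (v \in H) && (deg_in H v <= t)];
  last first.
  apply: long_cycle_min_degree => // v vH.
  by have := hd v; rewrite vH /= -ltnNge.
have cH := cardsD1 v H; rewrite vH in cH.
move: dense; rewrite (edges_setD1 vH) => dense.
have [H1|H1] := eqVneq (H :\ v) set0.
  move: dense; rewrite H1 {1}/edges big_set0 add0n.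
  have -> : deg_in H v = 0.
    apply/eqP; rewrite cards_eq0 -subset0; apply/subsetP => y; rewrite !inE => /andP[evy yH].
    have : y \in H :\ v by rewrite !inE yH andbT; apply: contraTneq evy => ->; rewrite e_irr.
    by rewrite H1 inE.
  by rewrite cH H1 cards0; nia.
have [||O [s1 s2 s3 s4]] := IH (H :\ v) _ H1.
- by rewrite -ltnS; slia.
- by rewrite cH in dense; nia.
by exists O; split=> // w /s4 /setD1P[].
Qed.

End LongestCycle.

(** * Connectivity of vertex-transitive graphs *)

Section Boundary.
Variables (T : finType) (e : rel T).
Hypotheses (e_sym : symmetric e) (e_irr : irreflexive e).
Implicit Types (A B S X Y : {set T}) (g : {perm T}).

Definition boundary X : {set T} := [set y | (y \notin X) && [exists x in X, e x y]].
Definition exterior X := ~: (X :|: boundary X).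
(** For such X the boundary is a vertex cut, separating X from the nonempty exterior. *)
Definition fragment X := (X != set0) && (exterior X != set0).

Lemma boundaryP X y :
  reflect (y \notin X /\ exists2 x, x \in X & e x y) (y \in boundary X).
Proof.
rewrite inE; apply: (iffP andP) => -[yX].
  by move=> /existsP[x /andP[xX exy]]; split=> //; exists x.
by case=> x xX exy; split=> //; apply/existsP; exists x; rewrite xX.
Qed.

Lemma boundary_submod A B :
  #|boundary (A :&: B)| + #|boundary (A :|: B)| <= #|boundary A| + #|boundary B|.
Proof.
rewrite -cardsUI -[X in _ <= X]cardsUI; apply: leq_add; apply/subset_leq_card/subsetP => y.
  rewrite !inE => /orP[]/andP[].
    rewrite negb_and => /orP[yA|yB] /existsP[x /andP[]]; rewrite inE => /andP[xA xB] exy;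
    apply/orP; [left; rewrite yA|right; rewrite yB] => /=; apply/existsP; exists x; exact/andP.
  rewrite negb_or => /andP[yA yB] /existsP[x /andP[]]; rewrite inE => /orP[xA|xB] exy;
  apply/orP; [left; rewrite yA|right; rewrite yB] => /=; apply/existsP; exists x; exact/andP.
rewrite !inE => /andP[/andP[_ /existsP[x /andP[]]]]; rewrite inE => /andP[xA xB] exy.
rewrite negb_or => /andP[/andP[-> ->] _]; rewrite !andTb.
by apply/andP; split; apply/existsP; exists x; apply/andP.
Qed.

Lemma exteriorS A B : A \subset B -> exterior B \subset exterior A.
Proof.
move=> /subsetP sAB; rewrite setCS; apply/subsetP => y; rewrite !inE.
case yB: (y \in B) => //= /orP[/sAB|/andP[_ /existsP[x /andP[xA exy]]]]; first by rewrite yB.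
by apply/existsP; exists x; rewrite sAB.
Qed.

Lemma boundary_exterior A : boundary (exterior A) \subset boundary A.
Proof.
apply/subsetP => y /boundaryP[]; rewrite !inE negbK => yA [z zE ezy].
case/orP: yA => // yA; move: zE; rewrite !inE negb_or => /andP[zA].
by rewrite zA /= => /existsP; case; exists y; rewrite yA e_sym.
Qed.

Lemma sub_exterior2 A : A \subset exterior (exterior A).
Proof.
apply/subsetP => y yA; rewrite inE inE negb_or; apply/andP; split.
  by rewrite !inE yA.
by apply/negP => /(subsetP (boundary_exterior A)) /boundaryP[]; rewrite yA.
Qed.

Lemma card_fragment A : #|T| = #|A| + #|boundary A| + #|exterior A|.
Proof.
rewrite -(cardsC (A :|: boundary A)); congr (_ + _).
rewrite cardsU; have -> : A :&: boundary A = set0; last by rewrite cards0 subn0.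
by apply/setP => y; rewrite !inE; case: (y \in A).
Qed.

Lemma fragment_sub A B : A != set0 -> A \subset B -> fragment B -> fragment A.
Proof.
move=> A0 AB /andP[_ EB]; rewrite /fragment A0 /=; apply: contra EB => /eqP EA.
by rewrite -subset0 -EA exteriorS.
Qed.

Lemma fragment_exterior A : fragment A -> fragment (exterior A).
Proof.
move=> /andP[A0 EA]; rewrite /fragment EA; apply: contra A0 => /eqP EEA.
by rewrite -subset0 -EEA sub_exterior2.
Qed.

Lemma boundary_aut g X : g \in graph_aut e -> boundary (g @: X) = g @: boundary X.
Proof.
move=> /graph_autP gA; apply/setP => y; rewrite -[y](permKV g); set z := (g^-1)%g y.
rewrite mem_imset; last exact: perm_inj.
apply/boundaryP/boundaryP => -[]; rewrite ?mem_imset; try exact: perm_inj.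
  by move=> zX [_ /imsetP[x xX ->]]; rewrite gA => exz; split=> //; exists x.
by move=> zX [x xX exz]; split=> //; exists (g x); rewrite ?imset_f ?gA.
Qed.

Variable d : nat.
Hypotheses (e_conn : forall x y, connect e x y) (e_reg : regular_graph e d)
  (e_vt : vertex_transitive e).

Lemma aut_move x y : exists2 g, g \in graph_aut e & g x = y.
Proof.
have := atransP2 e_vt (in_setT x) (in_setT y).
by case=> g gA /= ->; exists g.
Qed.

Lemma fragment_boundary_gt0 X : fragment X -> 0 < #|boundary X|.
Proof.
move=> /andP[/set0Pn[x xX] /set0Pn[y]]; rewrite !inE negb_or => /andP[yX _].
rewrite card_gt0; apply: contra yX => /eqP b0.
case/connectP: (e_conn x y) => p; elim: p x xX => [|z p IH] x xX /=; first by move=> _ ->.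
move=> /andP[exz pth] ly; apply: IH pth ly; apply/negPn/negP => zX.
have : z \in boundary X by apply/boundaryP; split=> //; exists x.
by rewrite b0 inE.
Qed.

(* Atoms: fragments of least size among those of least boundary.  Distinct
   translates of an atom are disjoint, and an atom A has at most #|boundary A|
   elements, while a closed neighbourhood has d + 1. *)
Lemma atom_bound A :
  fragment A -> (forall X, fragment X -> #|boundary A| <= #|boundary X|) ->
  (forall X, fragment X -> #|boundary X| <= #|boundary A| -> #|A| <= #|X|) ->
  d < 2 * #|boundary A|.
Proof.
move=> fA minb minA.
have lt_b X : fragment X -> #|X| < #|A| -> #|boundary A| < #|boundary X|.
  by move=> fX lt; rewrite ltnNge; apply/negP => /(minA X fX); rewrite leqNgt lt.
have gt_b X : #|boundary X| < #|boundary A| -> X != set0 -> exterior X = set0.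
  move=> lt X0; apply/eqP/negPn/negP => E0.
  by have := minb X; rewrite /fragment X0 E0 => /(_ isT); rewrite leqNgt lt.
have EA : #|A| <= #|exterior A|.
  by apply: minA (fragment_exterior fA) _; rewrite subset_leq_card ?boundary_exterior.
(* If gA meets A in a proper part, this smaller fragment has a larger boundary. By submodularity the
   union of gA and A has a smaller boundary than A, hence an empty exterior, and counting vertices
   contradicts [EA]. *)
have disj g : g \in graph_aut e -> g @: A :&: A != set0 -> A \subset g @: A.
  move=> gA I0; have cB : #|g @: A| = #|A| by rewrite card_imset //; apply: perm_inj.
  have bB : #|boundary (g @: A)| = #|boundary A|.
    by rewrite boundary_aut // card_imset //; apply: perm_inj.
  have [eI|nI] := eqVneq (g @: A :&: A) A; first by rewrite -{1}eI subsetIl.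
  have ltI : #|g @: A :&: A| < #|A|.
    by apply: proper_card; rewrite properEneq nI subsetIr.
  have := lt_b _ (fragment_sub I0 (subsetIr _ _) fA) ltI.
  have := boundary_submod (g @: A) A; rewrite bB => sub lt.
  have ltU : #|boundary (g @: A :|: A)| < #|boundary A| by lia.
  have EU : exterior (g @: A :|: A) = set0.
    apply: gt_b ltU _.
    by have /andP[/set0Pn[x xA] _] := fA; apply/set0Pn; exists x; rewrite inE xA orbT.
  have := card_fragment (g @: A :|: A); rewrite EU cards0.
  have := card_fragment A; have := cardsUI (g @: A) A; rewrite cB.
  have : 0 < #|g @: A :&: A| by rewrite card_gt0.
  lia.
have leA : #|A| <= #|boundary A|.
  have /card_gt0P[y yb] := fragment_boundary_gt0 fA.
  have /andP[/set0Pn[a aA] _] := fA.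
  (* The translate of A through its boundary vertex y is disjoint from A. Either it lies in the
     boundary, or submodularity for it and [exterior A] gives a union with empty exterior and a
     boundary smaller than that of A; A is contained in that boundary. *)
  have [g gA gay] := aut_move a y.
  have cB : #|g @: A| = #|A| by rewrite card_imset //; apply: perm_inj.
  have bB : #|boundary (g @: A)| = #|boundary A|.
    by rewrite boundary_aut // card_imset //; apply: perm_inj.
  have yB : y \in g @: A by rewrite -gay imset_f.
  have yA : y \notin A by case/boundaryP: yb.
  have I0 : g @: A :&: A = set0.
    apply/eqP/negPn/negP => /(disj g gA) sAB.
    have : A == g @: A by rewrite eqEcard sAB cB leqnn.
    by move=> /eqP eAB; rewrite eAB yB in yA.
  have [/eqP XR|X0] := boolP (g @: A :&: exterior A == set0).
    rewrite -cB; apply/subset_leq_card/subsetP => z zB.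
    have := in_set0 z; rewrite -{1}XR !inE zB /= => /negbFE /orP[zA|//].
    by have := in_set0 z; rewrite -{1}I0 inE zB zA.
  have fX : fragment (g @: A :&: exterior A).
    exact: fragment_sub X0 (subsetIr _ _) (fragment_exterior fA).
  have ltX : #|g @: A :&: exterior A| < #|A|.
    rewrite -cB; apply: proper_card; rewrite properE subsetIl /=.
    by apply/subsetPn; exists y; rewrite // in_setI yB /= in_setC negbK in_setU yb orbT.
  have := lt_b _ fX ltX; have := boundary_submod (g @: A) (exterior A); rewrite bB => sub lt.
  have bE := subset_leq_card (boundary_exterior A).
  have ltU : #|boundary (g @: A :|: exterior A)| < #|boundary A| by lia.
  have EU : exterior (g @: A :|: exterior A) = set0.
    by apply: gt_b ltU _; apply/set0Pn; exists y; rewrite inE yB.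
  apply: leq_trans (ltnW ltU); apply/subset_leq_card/subsetP => z zA.
  have := in_set0 z; rewrite -{1}EU inE => /negbFE; rewrite in_setU => /orP[|//].
  rewrite in_setU => /orP[zB|]; first by have := in_set0 z; rewrite -{1}I0 inE zB zA.
  by rewrite !inE zA.
have /andP[/set0Pn[a aA] _] := fA.
have : a |: [set y | e a y] \subset A :|: boundary A.
  apply/subsetP => y; rewrite 2!inE => /orP[/eqP ->|]; first by rewrite inE aA.
  rewrite inE in_setU => eay; have [//|yA] := boolP (y \in A).
  by apply/boundaryP; split=> //; exists a.
move=> /subset_leq_card; rewrite cardsU1 inE e_irr e_reg /= cardsU; lia.
Qed.

Lemma fragment_boundary X : fragment X -> d < 2 * #|boundary X|.
Proof.
move=> fX; have [Y fY' minY] := arg_minnP (fun X => #|boundary X|) fX.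
have fY : fragment Y := fY'.
pose P A := fragment A && (#|boundary A| <= #|boundary Y|).
have PY : P Y by rewrite /P fY leqnn.
have [A /andP[fA bA] minA] := arg_minnP (fun A : {set T} => #|A|) PY.
apply: leq_trans (_ : 2 * #|boundary A| <= _); last first.
  by rewrite leq_mul2l /= (leq_trans bA) // minY.
apply: atom_bound => // Z fZ; first by rewrite (leq_trans bA) // minY.
by move=> bZ; apply: minA; rewrite /P fZ (leq_trans bZ).
Qed.

(** If y were cut off, the vertices reachable from x outside S would form a fragment whose boundary
    lies in S. *)
Lemma vt_avoids_separators t : 2 * t <= d -> avoids_separators e t.
Proof.
move=> td S x y tS xS yS; apply/negPn/negP => nxy.
pose X := [set z | connect (rin e (~: S)) x z].
have bX : boundary X \subset S.
  apply/subsetP => z /boundaryP[]; rewrite inE => nz [w]; rewrite inE => xw ewz.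
  apply/negPn/negP => zS; case/negP: nz; apply: (connect_trans xw); apply: connect1.
  suff wS : w \notin S by rewrite /rin /= !inE wS zS ewz.
  case/connectP: xw => p; case/lastP: p => [_ /= ->|p u] //.
  by rewrite rcons_path last_rcons => /andP[_ /and3P[_ uS _]] ->; move: uS; rewrite inE.
have fX : fragment X.
  apply/andP; split; first by apply/set0Pn; exists x; rewrite inE connect0.
  apply/set0Pn; exists y; rewrite in_setC in_setU negb_or inE nxy /=.
  by apply: contra yS; apply: (subsetP bX).
by have := fragment_boundary fX; have := subset_leq_card bX; lia.
Qed.

End Boundary.

(** * Arcs cut out by two longest cycles *)

Section Reach.
Variables (T : finType) (e : rel T).
Hypotheses (e_sym : symmetric e) (e_irr : irreflexive e).
Implicit Types (A B S W X Y I J : {set T}) (s q C : seq T).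

(* No vertex other than v separates v from I. *)
Definition reach W I v :=
  [forall z, (z != v) ==> [exists x in I, connect (rin e ((W :|: I) :\ z)) v x]].

Lemma reachP W I v :
  reflect (forall z, z != v -> exists2 x, x \in I & connect (rin e ((W :|: I) :\ z)) v x)
    (reach W I v).
Proof.
apply: (iffP forallP) => h z; first by move=> zv; have := h z; rewrite zv => /exists_inP.
by apply/implyP => zv; apply/exists_inP; apply: h.
Qed.

Lemma connect_rin_in W x y : connect (rin e W) x y -> x = y \/ x \in W /\ y \in W.
Proof.
case/connectP=> [[|z p]]; first by move=> _ ->; left.
move=> pth ->; right; split; first by case/andP: pth => /and3P[].
case/lastP: p => [|p w] in pth *; first by case/andP: pth => /and3P[].
by move: pth; rewrite -rcons_cons rcons_path last_rcons => /andP[_ /and3P[]].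
Qed.

Lemma reach_in W I v z : z != v -> reach W I v -> v \in W :|: I.
Proof.
move=> zv /reachP/(_ z zv)[x xI /connect_rin_in[->|[]]]; first by rewrite inE xI orbT.
by rewrite inE => /andP[].
Qed.

Lemma reach_self W I v : v \in I -> reach W I v.
Proof. by move=> vI; apply/reachP => z _; exists v. Qed.

(** A deleted vertex z other than v equals at most one of u and u'; the other neighbour still leads
    to I. *)
Lemma reach_step W I v u u' : v \in W -> e v u -> e v u' -> u != u' ->
  reach W I u -> reach W I u' -> reach W I v.
Proof.
move=> vW vu vu' uu' ru ru'; apply/reachP => z zv.
have key w : e v w -> reach W I w -> z != w ->
    exists2 x, x \in I & connect (rin e ((W :|: I) :\ z)) v x.
  move=> vw rw zw; have vnw : v != w by apply: contraTneq vw => ->; rewrite e_irr.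
  have wWI := reach_in vnw rw.
  have [x xI wx] := reachP _ _ _ rw z zw; exists x => //.
  apply: connect_trans (connect1 _) wx.
  by rewrite /rin /= !in_setD1 wWI vw in_setU vW /= andbT eq_sym zv eq_sym zw.
have [zu|zu] := eqVneq z u; first by apply: key vu' ru' _; rewrite zu.
exact: key vu ru zu.
Qed.

(** Count incidences. An index in at most one set contributes at most 1, any other at most [#|U|];
    with fewer than i indices of the second kind the total stays below [#|U| * i]. *)
Lemma twice_covered p (U : {set T}) (S : T -> {set 'I_p}) i :
  0 < i -> p < #|U| -> {in U, forall u, i <= #|S u|} ->
  i <= #|[set k : 'I_p | 1 < #|[set u in U | k \in S u]|]|.
Proof.
move=> i0 pU hS; set N := [set k | _].
have le1 : #|U| * i <= \sum_(u in U) #|S u|.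
  by rewrite -sum_nat_const; apply: leq_sum => u /hS.
have eq2 : \sum_(u in U) #|S u| = \sum_(k : 'I_p) #|[set u in U | k \in S u]|.
  rewrite (eq_bigr (fun u => \sum_(k : 'I_p) (k \in S u))); last first.
    by move=> u _; rewrite -sum1_card big_mkcond /=; apply: eq_bigr => k _; case: (k \in S u).
  rewrite exchange_big /=; apply: eq_bigr => k _.
  by rewrite -sum1dep_card big_mkcondr; apply: eq_bigr => u _; case: (k \in S u).
have le3 : \sum_(k : 'I_p) #|[set u in U | k \in S u]| <= \sum_(k : 'I_p) (1 + (k \in N) * #|U|.-1).
  apply: leq_sum => k _; rewrite inE.
  have := subset_leq_card (subsetIl U [set u | k \in S u]).
  have -> : [set u in U | k \in S u] = U :&: [set u | k \in S u].
    by apply/setP => u; rewrite !inE.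
  by case: (ltnP 1 #|_|); lia.
have eq4 : \sum_(k : 'I_p) (1 + (k \in N) * #|U|.-1) = p + #|N| * #|U|.-1.
  rewrite big_split /= sum_nat_const card_ord muln1; congr (_ + _).
  rewrite -big_distrl /=; congr (_ * _).
  by rewrite -[RHS]sum1_card [RHS]big_mkcond /=; apply: eq_bigr => k _; case: (k \in N).
rewrite leqNgt; apply/negP => lt.
have : #|U| * i <= p + #|N| * #|U|.-1 by rewrite -eq4 (leq_trans le1) // eq2.
nia.
Qed.

Definition reached p W (I : 'I_p -> {set T}) v := [set k | reach W (I k) v].

(** More than p neighbours reaching at least i arcs each have i arcs that two of them reach, and
    such an arc is reached by v. Thus a vertex outside the set of vertices reaching i arcs has at
    most p neighbours in it. *)
Lemma reached_closed p W (I : 'I_p -> {set T}) v i : 0 < i -> v \in W ->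
  p < #|nbrs e v :&: [set u | i <= #|reached W I u|]| -> i <= #|reached W I v|.
Proof.
set U := _ :&: _ => i0 vW pU.
have := @twice_covered p U (reached W I) i i0 pU.
move=> /(_ _)/leq_trans; apply; first by move=> u; rewrite !inE => /andP[].
apply/subset_leq_card/subsetP => k; rewrite !inE => /card_gt1P[u [u' []]].
rewrite !inE => /andP[/andP[vu _] ru] /andP[/andP[vu' _] ru'] nuu.
exact: reach_step vu vu' nuu ru ru'.
Qed.

End Reach.

Section Arcs.
Variables (T : finType) (e : rel T).
Hypotheses (e_sym : symmetric e) (e_irr : irreflexive e).
Implicit Types (A B S W X Y I J : {set T}) (s q C : seq T).

(* The arcs are the maximal runs of C outside C'; arc k comes after exactly k + 1
   vertices of C', counting from the head of C, so C has to start in C'. *)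
Definition arc_rank C C' x := count (mem C') (take (index x C) C).
Definition arc_of C C' k : {set T} :=
  [set x in C | (x \notin C') && (arc_rank C C' x == k.+1)].
Definition free C C' : {set T} := ~: ([set x in C] :|: [set x in C']).

Lemma freeC C C' : free C C' = free C' C.
Proof. by rewrite /free setUC. Qed.

Lemma in_free C C' x : (x \in free C C') = (x \notin C) && (x \notin C').
Proof. by rewrite !inE negb_or. Qed.

Lemma hitC (C C' : seq T) : hit C C' = hit C' C.
Proof. by rewrite /hit setIC. Qed.

Lemma hit_count (C C' : seq T) : uniq C -> hit C C' = count (mem C') C.
Proof.
move=> uC; rewrite -size_filter -(card_uniqP (filter_uniq _ uC)).
by apply: eq_card => x; rewrite !inE mem_filter andbC.
Qed.

Lemma arc_cover C C' x0 C0 x : uniq C -> C = x0 :: C0 -> x0 \in C' -> x \in C -> x \notin C' ->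
  exists k : 'I_(hit C C'), x \in arc_of C C' k.
Proof.
move=> uC eC x0C' xC xC'.
have r0 : 0 < arc_rank C C' x.
  rewrite /arc_rank eC /=; case: eqP => [ex|_] /=; last by rewrite x0C'.
  by rewrite -ex x0C' in xC'.
have rp : (arc_rank C C' x).-1 < hit C C'.
  have -> : hit C C' = arc_rank C C' x + count (mem C') (drop (index x C) C).
    by rewrite hit_count // /arc_rank -count_cat cat_take_drop.
  by rewrite prednK // leq_addr.
by exists (Ordinal rp); rewrite inE xC xC' /= prednK.
Qed.

Lemma arc_segment C C' k x y : longest e C -> x \in arc_of C C' k -> y \in arc_of C C' k ->
  index x C < index y C ->
  exists s, [/\ index y C = index x C + (size s).+1, path e x (rcons s y), uniq (x :: s),
      y \notin s & {in s, forall v, (v \in C) && (v \notin C')}].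
Proof.
rewrite !inE => lC /and3P[xC xC' /eqP rx] /and3P[yC yC' /eqP ry] lt.
have [h3 cC uC] := longest_cycle lC.
have [s0 [s1 [s2 [eC ix iy]]]] := index_split xC yC lt.
exists s1; split.
- by rewrite iy ix.
- move: cC; rewrite eC -(rot_cycle (size s0)) rot_size_cat /= -catA rcons_cat cat_path /=.
  by move=> /and3P[p1 l1 _]; rewrite rcons_path p1.
- by move: uC; rewrite eC cat_uniq -cat_cons cat_uniq => /and3P[_ _ /and3P[]].
- move: uC; rewrite eC cat_uniq -cat_cons cat_uniq => /and3P[_ _ /and3P[_ /hasPn hy _]].
  by have := hy y (mem_head _ _); rewrite /= inE negb_or => /andP[].
have : count (mem C') s1 = 0.
  have : arc_rank C C' y = arc_rank C C' x + count (mem C') s1.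
    have tx : take (index x C) C = s0 by rewrite ix {1}eC take_size_cat.
    have ty : take (index y C) C = s0 ++ x :: s1.
      by rewrite iy {1}eC -cat_cons catA take_size_cat // size_cat.
    by rewrite /arc_rank tx ty count_cat /= (negbTE xC').
  by rewrite rx ry; lia.
move=> c0 v vs; apply/andP; split; first by rewrite eC mem_cat inE mem_cat vs !orbT.
apply/negP => vC'; have : has (mem C') s1 by apply/hasP; exists v.
by rewrite has_count c0.
Qed.

Lemma arc_detour C C' k x y : longest e C -> x \in arc_of C C' k -> y \in arc_of C C' k ->
  x != y -> exists2 s, path e x (rcons s y) &
    [/\ uniq s, x \notin s, y \notin s, {in s, forall v, (v \in C) && (v \notin C')}
     & forall q, path e x (rcons q y) -> uniq q -> {in q, forall v, v \notin C} ->
         size q <= size s].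
Proof.
wlog lt : x y / index x C < index y C.
  move=> hw lC xk yk nxy.
  have [lt|gt|eqi] := ltngtP (index x C) (index y C); first exact: hw.
    have [s ps [us xs ys hs hq]] := hw y x gt lC yk xk (contra_neq esym nxy).
    exists (rev s); first exact: path_flip.
    rewrite rev_uniq !mem_rev size_rev; split=> // [v|q pq uq qC].
      by rewrite mem_rev => /hs.
    rewrite -(size_rev q); apply: hq; rewrite ?rev_uniq //; first exact: path_flip.
    by move=> v; rewrite mem_rev => /qC.
  move: xk yk nxy; rewrite !inE => /andP[xC _] /andP[yC _].
  by rewrite -(nth_index x xC) eqi nth_index // eqxx.
move=> lC xk yk nxy; have [s [ei ps /andP[xs us] ys hs]] := arc_segment lC xk yk lt.
have [xC yC] : x \in C /\ y \in C by move: xk yk; rewrite !inE => /andP[-> _] /andP[-> _].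
exists s => //; split=> // q pq uq qC.
by have := detour_index e_sym lC xC yC lt pq uq qC; rewrite ei; slia.
Qed.

(* Otherwise two disjoint links between the arcs let each cycle borrow the other's
   segment, and one of the two resulting cycles is longer. *)
Lemma arcs_separated C1 C2 k l : longest e C1 -> longest e C2 ->
  exists z, forall x y, x \in arc_of C1 C2 k -> y \in arc_of C2 C1 l ->
    ~~ connect (rin e ((free C1 C2 :|: arc_of C1 C2 k :|: arc_of C2 C1 l) :\ z)) x y.
Proof.
move=> lC1 lC2; set I := arc_of _ _ _; set J := arc_of _ _ _; set W := _ :|: _ :|: _.
have IP v : v \in I -> (v \in C1) && (v \notin C2) by rewrite inE => /and3P[-> ->].
have JP v : v \in J -> (v \in C2) && (v \notin C1) by rewrite inE => /and3P[-> ->].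
have dIJ : [disjoint I & J].
  by apply/pred0P => v /=; apply/negP => /andP[/IP/andP[_ /negP vC2] /JP/andP[]].
apply/not_existsP => sep.
have [S|X [u [m [XJ cX hl hd]]]] := @menger_links T e W I J 2 dIJ.
  (* A separator with at most one vertex is enlarged to a singleton, because the negated claim
     speaks of a single z. *)
  rewrite ltnS => cS; have [z SZ] : exists z, S \subset [set z].
    move: cS; rewrite leq_eqVlt ltnS leqn0 => /orP[/cards1P[z ->]|]; first by exists z.
    rewrite cards_eq0 => /eqP ->; have [h3 _ _] := longest_cycle lC1.
    by case: (C1) h3 => // z *; exists z; rewrite sub0set.
  have := sep z; move/existsNP => [x /existsNP[y /not_implyP[xI /not_implyP[yJ /negP/negPn xy]]]].
  have nxy : x != y.
    apply: contraTneq (IP _ xI) => ->; move: (JP _ yJ) => /andP[-> _].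
    by rewrite andbF.
  have [xye|[xW yW]] := connect_rin_in xy; first by rewrite xye eqxx in nxy.
  have notS v : v \in W :\ z -> v \notin S.
    by rewrite !inE => /andP[vz _]; apply: contra vz => /(subsetP SZ); rewrite inE.
  exists x, y; rewrite !inE !notS //=; split=> //; try by move: xI yJ; rewrite !inE.
  apply: connect_rin_sub xy; apply/subsetP => v vW.
  by rewrite inE (notS _ vW) /=; move: vW; rewrite inE => /andP[].
have /cards2P[z1 [z2 [nz eX]]] : #|X| == 2 by rewrite cX.
have [z1X z2X] : z1 \in X /\ z2 \in X by rewrite eX !inE !eqxx orbT.
have [u1I pu1 um1 sm1] := hl _ z1X; have [u2I pu2 um2 sm2] := hl _ z2X.
have [nu dm] := hd _ _ z1X z2X nz.
have [z1J z2J] := (subsetP XJ _ z1X, subsetP XJ _ z2X).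
have mP v : v \in W :\: (I :|: J) -> (v \notin C1) && (v \notin C2).
  rewrite in_setD !in_setU -in_free negb_or => /andP[/andP[/negbTE -> /negbTE ->]].
  by rewrite !orbF.
have m1P v : v \in m z1 -> (v \notin C1) && (v \notin C2) by move/sm1/mP.
have m2P v : v \in m z2 -> (v \notin C1) && (v \notin C2) by move/sm2/mP.
have [s1 ps1 [us1 u1s u2s s1P s1max]] := arc_detour lC1 u1I u2I nu.
have [s2 ps2 [us2 z1s z2s s2P s2max]] := arc_detour lC2 z1J z2J nz.
(* Through the two links C2 can use s1 with its two ends in place of s2, hence
   [size s1 + 2 <= size s2]. Exchanging the roles gives the opposite inequality. *)
have q2 := path_join e_sym pu1 pu2 ps1.
have uq2 : uniq (rev (m z1) ++ u z1 :: s1 ++ u z2 :: m z2).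
  apply: (@path_join_uniq _ _ _ _ _ _ [set v in C1]) => //.
  - by move=> v /m1P; rewrite inE => /andP[].
  - by move=> v /m2P; rewrite inE => /andP[].
  - by rewrite inE; case/andP: (IP _ u1I).
  - by rewrite inE; case/andP: (IP _ u2I).
  - by move=> v /s1P; rewrite inE => /andP[].
have le2 := s2max _ q2 uq2.
have q1 := path_join e_sym (path_flip e_sym pu1) (path_flip e_sym pu2) ps2.
have uq1 : uniq (rev (rev (m z1)) ++ z1 :: s2 ++ z2 :: rev (m z2)).
  apply: (@path_join_uniq _ _ _ _ _ _ [set v in C2]); rewrite ?rev_uniq //.
  - by rewrite (eq_disjoint (mem_rev _)) (eq_disjoint_r (mem_rev _)).
  - by move=> v; rewrite mem_rev => /m1P; rewrite inE => /andP[].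
  - by move=> v; rewrite mem_rev => /m2P; rewrite inE => /andP[].
  - by rewrite inE; case/andP: (JP _ z1J).
  - by rewrite inE; case/andP: (JP _ z2J).
  - by move=> v /s2P; rewrite inE => /andP[].
have le1 := s1max _ q1 uq1.
have {le1} : size s2 + 2 <= size s1.
  apply: leq_trans (le1 _); first by rewrite !size_cat /= size_cat /=; slia.
  move=> v; rewrite revK mem_cat inE mem_cat inE mem_rev.
  case/or3P=> [/m1P/andP[]//|/eqP ->|/or3P[/s2P/andP[]//|/eqP ->|/m2P/andP[]//]].
    by case/andP: (JP _ z1J).
  by case/andP: (JP _ z2J).
have : size s1 + 2 <= size s2.
  apply: leq_trans (le2 _); first by rewrite !size_cat /= size_cat /=; slia.
  move=> v; rewrite mem_cat inE mem_cat inE mem_rev.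
  case/or3P=> [/m1P/andP[]//|/eqP ->|/or3P[/s1P/andP[]//|/eqP ->|/m2P/andP[]//]].
    by case/andP: (IP _ u1I).
  by case/andP: (IP _ u2I).
slia.
Qed.

End Arcs.

(** * Separators between a disjoint cycle and the arcs *)

Section CycleReach.
Variables (T : finType) (e : rel T).
Hypotheses (e_sym : symmetric e) (e_irr : irreflexive e).
Implicit Types (A B S W X Y I J : {set T}) (s q C O : seq T).

Lemma cycle_minus_connect O (D : {set T}) z x y : path.cycle e O -> uniq O -> {subset O <= D} ->
  x \in O -> y \in O -> z != x -> z != y -> connect (rin e (D :\ z)) x y.
Proof.
move=> cO uO OD xO yO zx zy.
have [->|nxy] := eqVneq x y; first exact: connect0.
have [i p1 p2 _ _ er] := rot_to_arc uO xO yO nxy.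
move: cO uO; rewrite -(rot_cycle i) -(rot_uniq i) er /=.
rewrite rcons_cat /= cat_path /= => /and3P[px pl py].
rewrite mem_cat cat_uniq !inE !negb_or /= => /andP[_ /and4P[_ /andP[_ d12] _ _]].
have eO v : (v \in O) = (v \in x :: p1 ++ y :: p2) by rewrite -er mem_rot.
have key a p b : a \in O -> b \in O -> z != a -> z != b -> {subset p <= O} -> z \notin p ->
    path e a (rcons p b) -> connect (rin e (D :\ z)) a b.
  move=> aO bO za zb; elim: p a aO za => [|w p IH] a aO za sp zp /=.
    rewrite andbT => eab; apply: connect1.
    by rewrite /rin /= !in_setD1 eq_sym za eq_sym zb !OD.
  move=> /andP[eaw pth].
  have zw : z != w by move: zp; rewrite inE negb_or => /andP[].
  have wO : w \in O by apply: sp; rewrite mem_head.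
  apply: (@connect_trans _ _ w); last first.
    apply: IH pth => // [v vp|]; first by apply: sp; rewrite inE vp orbT.
    by move: zp; rewrite inE negb_or => /andP[].
  by apply: connect1; rewrite /rin /= !in_setD1 eq_sym za eq_sym zw !OD.
have [z1|z1] := boolP (z \in p1); last first.
  apply: (key x p1) => //; last by rewrite rcons_path px.
  by move=> v vp; rewrite eO inE mem_cat vp orbT.
rewrite (sym_connect_sym (rin_sym e_sym _)).
apply: (key y p2) => //.
  by move=> v vp; rewrite eO inE mem_cat inE vp !orbT.
by apply: contraL z1; move/hasPn: d12; apply.
Qed.

Definition separating W A B S :=
  [forall x in A :\: S, forall y in B :\: S, ~~ connect (rin e (W :\: S)) x y].

Lemma separatingP W A B S :
  reflect (forall x y, x \in A :\: S -> y \in B :\: S -> ~~ connect (rin e (W :\: S)) x y)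
    (separating W A B S).
Proof.
apply: (iffP 'forall_in_forall_inP); first by move=> h x y xA yB; apply: h.
by move=> h x xA y yB; apply: h.
Qed.

Lemma path_restrict (D B D' : {set T}) x p : path (rin e D) x p -> ~~ has [in B] (belast x p) ->
  last x p \in D' -> D :\: B \subset D' -> path (rin e D') x p.
Proof.
move=> + + + /subsetP sD; elim: p x => //= y p IH x /andP[/and3P[xD yD exy] pth].
rewrite negb_or => /andP[xB nB] lD'; rewrite IH // /rin /= exy !andbT.
rewrite sD ?in_setD ?xB //=; case: p pth nB lD' {IH} => //= z p _ /norP[yB _] _.
by rewrite sD // in_setD yB.
Qed.

Lemma arc_links C1 C2 O k r : longest e C1 -> path.cycle e O -> uniq O ->
  {in O, forall v, v \in free C1 C2} -> let I := arc_of C1 C2 k in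
  (forall S, separating (free C1 C2 :|: I) [set x in O] I S -> r <= #|S|) ->
  exists X u m, [/\ X \subset I, #|X| = r, links e O C1 X u m
    & {in X, forall z, {in m z, forall v, v \notin C2}}].
Proof.
move=> lC1 cO uO Ofree I minS.
have IP v : v \in I -> (v \in C1) && (v \notin C2) by rewrite inE => /and3P[-> ->].
have dOI : [disjoint [set x in O] & I].
  apply/pred0P => v /=; rewrite inE; apply/negP => /andP[/Ofree + /IP/andP[vC1 _]].
  by rewrite in_free vC1.
have [S lt|X [u [m [XI cX hl hd]]]] := @menger_links T e (free C1 C2 :|: I) _ I r dOI.
  have : ~~ separating (free C1 C2 :|: I) [set x in O] I S.
    by apply/negP => /minS; rewrite leqNgt lt.
  rewrite /separating negb_forall_in => /exists_inP[x xO].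
  rewrite negb_forall_in => /exists_inP[y yI]; rewrite negbK => xy.
  by exists x, y.
exists X, u, m; split=> //; first split=> //.
- by move=> z /(subsetP XI)/IP/andP[].
- move=> z /hl[uz pz mz sz]; split=> // [|v /sz]; first by rewrite inE in uz.
  rewrite in_setD !in_setU inE negb_or => /andP[/andP[vO vI]].
  by rewrite (negbTE vI) orbF in_free vO => /andP[->].
- move=> z zX v; have [_ _ _ sz] := hl z zX; move=> /sz.
  rewrite in_setD !in_setU negb_or => /andP[/andP[_ vI]].
  by rewrite (negbTE vI) orbF in_free => /andP[_ ->].
Qed.

Lemma arc_link_count (t r g l s q c : nat) : 0 < r -> t < l -> l + 4 <= 2 * g ->
  r * g <= s + 1 -> l + 2 <= 2 * q ->
  (t < 2 + s + q -> t * (2 + s + q + 4) < 2 * c) -> t * t * r.+1 <= t * t + 4 * c.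
Proof.
move=> r0 tl lg rg lq h.
have gs : g <= s + 1 := leq_trans (leq_pmull g r0) rg.
have {}h : t * (2 + s + q + 4) < 2 * c by apply: h; lia.
have rt : r * t <= 2 * (s + 1).
  apply: leq_trans (_ : 2 * (r * g) <= _); last by rewrite leq_mul2l.
  by rewrite mulnCA leq_mul2l; apply/orP; right; lia.
have rt2 : t * (r * t) <= t * (2 * (s + 1)) by rewrite leq_mul2l rt orbT.
rewrite mulnS leq_add2l -mulnA [t * r]mulnC; apply: leq_trans rt2 _.
rewrite mulnCA; apply: leq_trans (_ : 2 * (2 * c) <= _); last by lia.
rewrite leq_mul2l; apply: leq_trans (ltnW h); rewrite leq_mul2l; apply/orP; right; lia.
Qed.

(** Take S of least size. Its links end on the arc at places at least half of [size O + 4] apart, so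
    they span a segment of the arc whose length grows like t / 2 per link. A bridge through O closes
    this segment to a cycle off C2, whose length [disjoint_cycle_bound] limits. If S has more than
    one vertex, no single vertex cuts O from the arc, and any vertex of O can go round O to a path
    that survives. *)
Lemma arc_separator t C1 C2 O k : 1 < t -> avoids_separators e t ->
  longest e C1 -> longest e C2 -> t < size O -> path.cycle e O -> uniq O ->
  {in O, forall v, v \in free C1 C2} -> let I := arc_of C1 C2 k in
  exists S : {set T}, [/\ separating (free C1 C2 :|: I) [set x in O] I S,
    t * t * #|S| <= t * t + 4 * size C1
    & 1 < #|S| -> {in O, forall v, reach e (free C1 C2) I v}].
Proof.
move=> t1 av lC1 lC2 tO cO uO Ofree I; set W := free C1 C2.
have IP v : v \in I -> (v \in C1) && (v \notin C2) by rewrite inE => /and3P[-> ->].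
have dO1 : {in O, forall v, v \notin C1} by move=> v /Ofree; rewrite in_free => /andP[].
have dO2 : {in O, forall v, v \notin C2} by move=> v /Ofree; rewrite in_free => /andP[].
have sepI : separating (W :|: I) [set x in O] I I.
  by apply/separatingP => x y _; rewrite setDv inE.
have [S sepS minS] := arg_minnP (fun S : {set T} => #|S|) sepI.
exists S; split=> //.
  have [X [u [m [XI cX lk m2]]]] := arc_links lC1 cO uO Ofree minS.
  case: (leqP #|S| 1) => [le1|].
    by rewrite (leq_trans (leq_mul (leqnn _) le1)) // muln1 leq_addr.
  case: #|S| cX => [//|r] cX r0.
  have [x [y [xX yX le]]] := links_spread e_sym lC1 cO uO dO1 lk cX.
  have lt : index x C1 < index y C1.
    by apply: leq_trans le; rewrite -addn1 leq_add2l muln_gt0 uphalf_gt0 addn_gt0 orbT andbT.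
  have nxy : x != y by apply: contraTneq lt => ->; rewrite ltnn.
  have [q pq [uq sq dq qs]] := links_bridge e_sym cO uO dO1 lk xX yX nxy.
  have xI := subsetP XI _ xX; have yI := subsetP XI _ yX.
  have [/andP[xC1 xC2] /andP[yC1 yC2]] := (IP _ xI, IP _ yI).
  have [s [ei ps us ys hs]] := arc_segment lC1 xI yI lt.
  have q2 : {in q, forall v, v \notin C2}.
    by move=> v /qs/or3P[/dO2//|/(m2 _ xX)//|/(m2 _ yX)//].
  have cO' : path.cycle e (x :: s ++ y :: rev q).
    rewrite /= rcons_cat cat_path /= path_flip //.
    by move: ps; rewrite rcons_path => /andP[-> ->].
  have uO' : uniq (x :: s ++ y :: rev q).
    rewrite -cat_cons cat_uniq us cons_uniq rev_uniq uq mem_rev !andbT.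
    have yq : y \notin q by apply/negP => yq; have := dq y yq; rewrite yC1.
    rewrite yq andbT; apply/hasPn => v; rewrite inE mem_rev => /orP[/eqP ->|/dq vC1].
      by rewrite /= inE negb_or ys eq_sym nxy.
    apply: contra vC1; rewrite /= inE => /orP[/eqP ->//|/hs/andP[]//].
  have dO' : {in x :: s ++ y :: rev q, forall v, v \notin C2}.
    move=> v; rewrite inE mem_cat inE mem_rev.
    by case/or3P=> [/eqP ->|/hs/andP[]|/orP[/eqP ->|/q2]].
  have sO' : size (x :: s ++ y :: rev q) = 2 + size s + size q.
    by rewrite /= size_cat /= size_rev; slia.
  have := disjoint_cycle_bound e_sym av lC2 t1 _ cO' uO' dO'.
  have sC : size C2 = size C1 by case/andP: lC1 => _ /eqP ->; case/andP: lC2 => _ /eqP ->.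
  rewrite sO' sC => h3.
  apply: (@arc_link_count t r (uphalf (size O + 4)) (size O) (size s) (size q)) => //; slia.
move=> gt1 v vO; apply/reachP => z zv.
have : ~~ separating (W :|: I) [set x in O] I [set z].
  by apply/negP => /minS; rewrite cards1 leqNgt gt1.
rewrite /separating negb_forall_in => /exists_inP[x xO].
rewrite negb_forall_in => /exists_inP[y yI]; rewrite negbK => xy.
move: xO yI; rewrite !in_setD !in_set1 [x \in [set _ in _]]inE => /andP[xz xO] /andP[yz yI].
exists y => //; apply: connect_trans xy.
apply: cycle_minus_connect cO uO _ vO xO zv _; last by rewrite eq_sym.
by move=> w /Ofree wf; rewrite inE wf.
Qed.

Lemma card_bigcup_le (I : finType) (F : I -> {set T}) : #|\bigcup_i F i| <= \sum_i #|F i|.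
Proof.
elim/big_rec2: _ => [|i m S _ le]; first by rewrite cards0.
by rewrite cardsU; apply: leq_trans (leq_subr _ _) _; rewrite leq_add2l.
Qed.

Definition reached_arcs C1 C2 v : {set 'I_(hit C1 C2)} :=
  reached e (free C1 C2) (fun k : 'I_(hit C1 C2) => arc_of C1 C2 k) v.

Definition based C C' := exists x, exists2 s, C = x :: s & x \in C'.

(** More than t vertices must come from the p common vertices and 2p separators. A separator has
    size at most 1, or at most 1 + 4c / t^2 if it is large. As 6p <= t, the excess over 3p is more
    than t / 2, so there are more than t^3 / (8c) large separators, and one of the two cycles has
    more than t^3 / (16c) of them. *)
Definition arc_threshold t c := (t ^ 3 %/ (16 * c)).+1.

Lemma arc_sum_count (t p c k1 k2 s1 s2 : nat) : 1 < t -> 6 * p <= t ->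
  t * t * s1 <= p * (t * t) + k1 * (4 * c) -> t * t * s2 <= p * (t * t) + k2 * (4 * c) ->
  t < p + (s1 + s2) -> k1 * (16 * c) <= t ^ 3 -> k2 * (16 * c) <= t ^ 3 -> False.
Proof.
move=> t1 tp; have -> : t ^ 3 = t * t * t by rewrite !expnS muln1 mulnA.
have a0 : 0 < t * t by rewrite muln_gt0 ltnW.
move: (t * t) a0 => a a0 le1 le2 lt le3 le4.
have := leq_mul (leqnn a) lt; rewrite mulnS !mulnDr [a * p]mulnC => le5.
have le6 : 6 * (p * a) <= a * t by rewrite mulnA [X in _ <= X]mulnC leq_mul2r tp orbT.
lia.
Qed.

Lemma cycle_reaches_arcs t C1 C2 O : 1 < t -> avoids_separators e t ->
  longest e C1 -> longest e C2 -> based C1 C2 -> based C2 C1 -> 6 * hit C1 C2 <= t ->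
  t < size O -> path.cycle e O -> uniq O -> {in O, forall v, v \in free C1 C2} ->
  {in O, forall v, arc_threshold t (size C1) <= #|reached_arcs C1 C2 v|} \/
  {in O, forall v, arc_threshold t (size C1) <= #|reached_arcs C2 C1 v|}.
Proof.
move=> t1 av lC1 lC2 [a1 [b1 e1 a1C2]] [a2 [b2 e2 a2C1]] tp tO cO uO Ofree.
have [h1 cC1 uC1] := longest_cycle lC1; have [h2 cC2 uC2] := longest_cycle lC2.
have sC : size C2 = size C1 by case/andP: lC1 => _ /eqP ->; case/andP: lC2 => _ /eqP ->.
have Ofree' : {in O, forall v, v \in free C2 C1} by move=> v /Ofree; rewrite freeC.
have [S1 hS1] := choice (fun k : 'I_(hit C1 C2) =>
  arc_separator k t1 av lC1 lC2 tO cO uO Ofree).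
have [S2 hS2] := choice (fun k : 'I_(hit C2 C1) =>
  arc_separator k t1 av lC2 lC1 tO cO uO Ofree').
pose K1 := [set k | 1 < #|S1 k|]; pose K2 := [set k | 1 < #|S2 k|].
(* Were Om of size at most t, a path off Om would lead from O to C1. The first vertex of C1 or C2 on
   it is not a common one, so it lies in some arc, and the separator chosen for that arc is
   contradicted. *)
pose Om := ([set x in C1] :&: [set x in C2]) :|: (\bigcup_k S1 k :|: \bigcup_k S2 k).
have ltOm : t < #|Om|.
  rewrite ltnNge; apply/negP => leOm.
  have ex (s : seq T) : uniq s -> t < size s -> exists2 x, x \in s & x \notin Om.
    move=> us ts; apply/hasP; rewrite -[has _ _]negbK -all_predC; apply/negP => /allP al.
    have : [set x in s] \subset Om.
      by apply/subsetP => x; rewrite inE => /al /=; rewrite negbK.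
    by move/subset_leq_card; rewrite card_seq_set // leqNgt (leq_ltn_trans leOm ts).
  have tC : t < size C1 := leq_trans tO (longest_max lC1 (leq_trans (t1 : 2 < t.+1) tO) cO uO).
  have [o oO oOm] := ex O uO tO; have [a aC1 aOm] := ex C1 uC1 tC.
  have /connectP[p pth la] := av Om o a leOm oOm aOm.
  pose B := [set x in C1] :|: [set x in C2].
  have [|q [q' [ep lq nq]]] := path_first_hit pth (S := B).
    by apply/hasP; exists a; [rewrite la mem_last|rewrite /= !inE aC1].
  move: pth; rewrite ep cat_path => /andP[pth _].
  have lOm : last o q \notin Om.
    case/lastP: q pth {lq nq ep} => // q z; rewrite rcons_path last_rcons.
    by move=> /andP[_ /and3P[_ + _]]; rewrite inE.
  have S1Om k x : x \notin Om -> x \notin S1 k.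
    apply: contra => xS; rewrite !inE; apply/orP; right; apply/orP; left.
    by apply/bigcupP; exists k.
  have S2Om k x : x \notin Om -> x \notin S2 k.
    apply: contra => xS; rewrite !inE; apply/orP; right; apply/orP; right.
    by apply/bigcupP; exists k.
  have : last o q \in B by [].
  have lI : ~~ ((last o q \in C1) && (last o q \in C2)).
    by apply: contra lOm => /andP[l1 l2]; rewrite !inE l1 l2.
  have fr : free C1 C2 = ~: B by [].
  rewrite in_setU !in_set; have [l1 _|l1 /= l2] := boolP (last o q \in C1).
    have l2 : last o q \notin C2 by rewrite l1 in lI.
    have [k lk] := arc_cover uC1 e1 a1C2 l1 l2.
    have [/separatingP sep _ _] := hS1 k.
    have : connect (rin e ((free C1 C2 :|: arc_of C1 C2 k) :\: S1 k)) o (last o q).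
      apply/connectP; exists q => //; apply: path_restrict pth nq _ _.
        by rewrite in_setD S1Om // in_setU lk orbT.
      apply/subsetP => x; rewrite fr in_setD => /andP[xB]; rewrite in_setC => xOm.
      by rewrite in_setD S1Om //= in_setU in_setC xB.
    by apply/negP/sep; rewrite in_setD S1Om //= inE oO.
  have [k lk] := arc_cover uC2 e2 a2C1 l2 l1.
  have [/separatingP sep _ _] := hS2 k.
  have : connect (rin e ((free C2 C1 :|: arc_of C2 C1 k) :\: S2 k)) o (last o q).
    apply/connectP; exists q => //; apply: path_restrict pth nq _ _.
      by rewrite in_setD S2Om // in_setU lk orbT.
    apply/subsetP => x; rewrite freeC fr in_setD => /andP[xB]; rewrite in_setC => xOm.
    by rewrite in_setD S2Om //= in_setU in_setC xB.
  by apply/negP/sep; rewrite in_setD S2Om //= inE oO.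
have sumS p (S : 'I_p -> {set T}) : (forall k, t * t * #|S k| <= t * t + 4 * size C1) ->
    t * t * #|\bigcup_k S k| <= p * (t * t) + #|[set k | 1 < #|S k|]| * (4 * size C1).
  move=> hS; apply: leq_trans (leq_mul (leqnn (t * t)) (card_bigcup_le S)) _.
  rewrite big_distrr /=.
  apply: leq_trans (_ : \sum_(k < p) (t * t + (1 < #|S k|) * (4 * size C1)) <= _).
    apply: leq_sum => k _; have := hS k; case: (ltnP 1 #|S k|) => [_|le1 _]; first by rewrite mul1n.
    by rewrite addn0 (leq_trans (leq_mul (leqnn _) le1)) // muln1.
  rewrite big_split /= sum_nat_const card_ord leq_add2l -big_distrl /= leq_mul2r.
  apply/orP; right; rewrite -sum1dep_card [X in _ <= X]big_mkcond /=.
  by apply: leq_sum => k _; case: ltnP.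
have le1 : t * t * #|\bigcup_k S1 k| <= hit C1 C2 * (t * t) + #|K1| * (4 * size C1).
  by apply: sumS => k; have [] := hS1 k.
have le2 : t * t * #|\bigcup_k S2 k| <= hit C1 C2 * (t * t) + #|K2| * (4 * size C1).
  by rewrite -[X in X * _ + _](hitC C2 C1); apply: sumS => k; have [_ + _] := hS2 k; rewrite sC.
have leOm : #|Om| <= hit C1 C2 + (#|\bigcup_k S1 k| + #|\bigcup_k S2 k|).
  have cU (A B : {set T}) : #|A :|: B| <= #|A| + #|B| by rewrite cardsU leq_subr.
  by apply: leq_trans (cU _ _) _; rewrite leq_add2l.
have c0 : 0 < 16 * size C1 by slia.
have K12 : (arc_threshold t (size C1) <= #|K1|) || (arc_threshold t (size C1) <= #|K2|).
  rewrite -[_ || _]negbK negb_or -!ltnNge !ltnS; apply/negP => /andP[].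
  rewrite !leq_divRL // => k1 k2.
  exact: arc_sum_count t1 tp le1 le2 (leq_trans ltOm leOm) k1 k2.
case/orP: K12 => le; [left|right] => v vO; apply: leq_trans le _;
  apply/subset_leq_card/subsetP => k; rewrite !inE.
  by have [_ _ h] := hS1 k => /h; apply.
by have [_ _ h] := hS2 k => /h; apply.
Qed.

End CycleReach.

(** * Hulls of cycles *)

Section Hull.
Variables (T : finType) (e : rel T) (d : nat).
Hypotheses (e_sym : symmetric e) (e_irr : irreflexive e) (e_reg : regular_graph e d).
Implicit Types (A B C P S W X Y : {set T}).

Lemma deg_in_sum Y x : deg_in e Y x = \sum_(y in Y) e x y.
Proof.
rewrite /deg_in -sum1_card; under eq_bigl => y do rewrite inE andbC.
by rewrite big_mkcondr; apply: eq_bigr => y _; rewrite inE; case: (e x y).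
Qed.

Lemma edges_sym X Y : edges e X Y = edges e Y X.
Proof.
rewrite /edges (eq_bigr (fun x => \sum_(y in Y) e x y)); last by move=> x _; apply: deg_in_sum.
rewrite exchange_big /=; apply: eq_bigr => y _; rewrite deg_in_sum.
by apply: eq_bigr => x _; rewrite e_sym.
Qed.

Lemma deg_in_le Y x : deg_in e Y x <= d.
Proof. by rewrite -(e_reg x) subset_leq_card ?subsetIl. Qed.

Lemma deg_inS Y Y' x : Y \subset Y' -> deg_in e Y x <= deg_in e Y' x.
Proof. by move=> sub; rewrite subset_leq_card ?setIS. Qed.

Lemma deg_inU Y Y' x : deg_in e (Y :|: Y') x <= deg_in e Y x + deg_in e Y' x.
Proof. by rewrite /deg_in setIUr cardsU leq_subr. Qed.

Lemma deg_inT x : deg_in e setT x = d.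
Proof. by rewrite /deg_in setIT -(e_reg x). Qed.

Lemma deg_in_split Y S x : Y \subset S -> deg_in e S x = deg_in e Y x + deg_in e (S :\: Y) x.
Proof.
move=> YS; rewrite !deg_in_sum (big_setID Y) /=; congr (_ + _).
by rewrite (setIidPr YS).
Qed.

Lemma edges_le X Y : edges e X Y <= d * #|X|.
Proof.
by rewrite mulnC -sum_nat_const; apply: leq_sum => x _; apply: deg_in_le.
Qed.

Lemma edges_splitr X Y S : Y \subset S ->
  edges e X S = edges e X Y + edges e X (S :\: Y).
Proof.
by move=> YS; rewrite /edges -big_split /=; apply: eq_bigr => x _; apply: deg_in_split.
Qed.

Lemma edges_split Y P : Y \subset P ->
  edges e P P = edges e (P :\: Y) (P :\: Y) + 2 * edges e Y (P :\: Y) + edges e Y Y.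
Proof.
move=> YP; rewrite (edges_splitr P YP) [edges e P Y]edges_sym.
rewrite [edges e P (P :\: Y)]edges_sym !(edges_splitr _ YP).
rewrite [edges e (P :\: Y) Y]edges_sym; lia.
Qed.

(* These hold for the P maximising 2 e(P) - (3/2) d |P|, with e(P) the number of edges
   inside P, among the sets containing C: compare P with C, with v |: P and with P :\: Y. *)
Definition hull C P := [/\ C \subset P, #|P| <= 3 * #|C|,
  forall v, v \notin P -> 4 * deg_in e P v <= 3 * d
  & forall Y, Y \subset P -> [disjoint Y & C] ->
      3 * d * #|Y| <= 2 * (2 * edges e Y (P :\: Y) + edges e Y Y)].

Lemma hull_exists C : 0 < d -> exists P, hull C P.
Proof.
(* Up to a constant this is twice the objective: [edges e X X] counts every edge twice, and the
   complement replaces a subtraction. *)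
move=> d0; pose f X := 2 * edges e X X + 3 * d * #|~: X|.
have [P CP' maxP] := arg_maxnP (P := fun X : {set T} => C \subset X) f (subxx C).
have CP : C \subset P := CP'; exists P; split=> //.
- have := maxP C (subxx C); rewrite /f => h.
  have := edges_le P P; have := cardsC P; have := cardsC C.
  have : 3 * d * #|~: C| <= 2 * (d * #|P|) + 3 * d * #|~: P|.
    apply: leq_trans (_ : f P <= _); last by rewrite leq_add2r leq_mul2l edges_le.
    by apply: leq_trans (leq_addl _ _) h.
  rewrite -!mulnA [d * #|~: C|]mulnC [d * #|~: P|]mulnC [d * #|P|]mulnC !mulnA -mulnDl.
  rewrite leq_pmul2r //; lia.
- move=> v vP; have := maxP (v |: P) (subset_trans CP (subsetUr _ _)).
  rewrite /f (edges_setD1 e_sym e_irr (setU11 v P)) setU1K //.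
  have -> : deg_in e (v |: P) v = deg_in e P v.
    apply: eq_card => y; rewrite !inE; case: eqP => // ->.
    by rewrite e_irr.
  have -> : #|~: P| = #|~: (v |: P)|.+1.
    by rewrite (cardsD1 v (~: P)) inE vP; congr (_.+1); apply: eq_card => y; rewrite !inE negb_or.
  rewrite mulnS; lia.
move=> Y YP dYC; have CPY : C \subset P :\: Y by rewrite subsetD CP disjoint_sym.
have := maxP _ CPY; rewrite /f (edges_split YP).
have -> : #|~: (P :\: Y)| = #|~: P| + #|Y|.
  have := cardsC (P :\: Y); have := cardsC P; rewrite cardsD (setIidPr YP).
  have := subset_leq_card YP; lia.
rewrite mulnDr; lia.
Qed.

Lemma deg_in_aut (g : {perm T}) Y x : g \in graph_aut e ->
  deg_in e (g @: Y) (g x) = deg_in e Y x.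
Proof.
move=> /graph_autP gA; rewrite /deg_in -[RHS](card_imset _ (@perm_inj _ g)).
apply: eq_card => y; rewrite -[y](permKV g) in_setI !mem_imset; try exact: perm_inj.
by rewrite !inE gA.
Qed.

Lemma edges_aut (g : {perm T}) X Y : g \in graph_aut e ->
  edges e (g @: X) (g @: Y) = edges e X Y.
Proof.
move=> gA; rewrite /edges big_imset /=; last by move=> x y _ _; apply: perm_inj.
by apply: eq_bigr => x _; apply: deg_in_aut.
Qed.

(** A cycle may have several hulls. Fixing one hull P and using its translates makes the hulls of
    random cycles accessible to averaging. *)
Lemma hull_aut (g : {perm T}) C P : g \in graph_aut e -> hull C P -> hull (g @: C) (g @: P).
Proof.
move=> gA [CP cP hv hY]; have ginj := @perm_inj _ g; split.
- exact: imsetS.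
- by rewrite !card_imset.
- by move=> v; rewrite -[v](permKV g) mem_imset // => /hv; rewrite deg_in_aut.
move=> Y; have -> : Y = g @: ((g^-1)%g @: Y).
  by rewrite -imset_comp (eq_imset (g := id)) ?imset_id // => y /=; rewrite permKV.
set Z := _ @: Y; clearbody Z; have <- : g @: (P :\: Z) = g @: P :\: g @: Z.
  by apply/setP => y; rewrite -[y](permKV g) in_setD !(mem_imset _ _ ginj) in_setD.
move=> sub dis; rewrite card_imset // !edges_aut //; apply: hY.
  by apply/subsetP => z zZ; rewrite -(mem_imset _ _ ginj); apply: (subsetP sub); rewrite imset_f.
apply/pred0P => z /=; apply/negP => /andP[zZ zC].
by move/pred0P/(_ (g z)): dis; rewrite /= !imset_f.
Qed.

End Hull.

(** * Equal or consecutive pairs along a sequence *)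

Section Pairs.
Variable T : eqType.
Implicit Types (s : seq T) (v w : T).

Definition close_pairs s : seq (T * T) := zip s s ++ zip s (behead s) ++ zip (behead s) s.

Lemma size_close_pairs s : size (close_pairs s) <= 3 * size s.
Proof. by rewrite !size_cat !size_zip size_behead; lia. Qed.

Lemma close_pairs_cons a s : {subset close_pairs s <= close_pairs (a :: s)}.
Proof.
move=> q; rewrite !mem_cat /= inE; case: s => //= b s; rewrite !inE.
by case/or3P => ->; rewrite ?orbT.
Qed.

Lemma close_pairs_path (e : rel T) s v w : symmetric e -> sorted e s ->
  (v, w) \in close_pairs s -> [/\ v \in s, w \in s & v = w \/ e v w].
Proof.
move=> e_sym; elim: s => // a s IH so.
have so' : sorted e s := path_sorted so.
have sub q : q \in close_pairs (a :: s) -> [|| q == (a, a), q == (a, head a s),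
    q == (head a s, a) | q \in close_pairs s].
  rewrite !mem_cat /= inE; case: s {IH so so'} => [|b s] /=; first by rewrite !orbF => ->.
  rewrite !inE; case/or3P => [/orP[->//|->]|/orP[->|->]|/orP[->|->]]; rewrite ?orbT //.
move=> /sub/or4P[/eqP[-> ->]|/eqP[-> ->]|/eqP[-> ->]|/(IH so')[vs ws h]].
- by rewrite mem_head; split=> //; left.
- case: s so {IH so' sub} => [|b s] /=; first by rewrite mem_head; split=> //; left.
  by move=> /andP[eab _]; rewrite !inE !eqxx orbT; split=> //; right.
- case: s so {IH so' sub} => [|b s] /=; first by rewrite mem_head; split=> //; left.
  by move=> /andP[eab _]; rewrite !inE !eqxx orbT; split=> //; right; rewrite e_sym.
- by rewrite !inE vs ws !orbT.
Qed.

Lemma close_pair_switch (a b : pred T) s : all (predU a b) s -> has a s -> has b s ->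
  exists v w, [/\ (v, w) \in close_pairs s, a v & b w].
Proof.
elim: s => // x s IH /= /andP[abx abs].
have [hb|nb] := boolP (has b s); have [ha|na] := boolP (has a s).
- move=> _ _; have [v [w [vw av bw]]] := IH abs ha hb; exists v, w; split=> //.
  exact: close_pairs_cons.
- rewrite orbF => ax _; case: s hb na abs {IH} => //= y s _; rewrite negb_or.
  move=> /andP[nay _] /andP[/orP[ay|by_] _]; first by rewrite ay in nay.
  by exists x, y; split=> //; rewrite /close_pairs !mem_cat /= !inE eqxx !orbT.
- rewrite orbF => _ bx; case: s ha nb abs {IH} => //= y s _; rewrite negb_or.
  move=> /andP[nby _] /andP[/orP[ay|by_] _]; last by rewrite by_ in nby.
  by exists y, x; split=> //; rewrite /close_pairs !mem_cat /= !inE eqxx !orbT.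
rewrite !orbF => ax bx; exists x, x; split=> //.
by rewrite /close_pairs mem_cat /= inE eqxx.
Qed.

End Pairs.

(** * A small set hitting all pairs with large rectangles *)

Section HittingPairs.
Variable T : finType.
Variables (p1 p2 : nat) (R1 : T -> {set 'I_p1}) (R2 : T -> {set 'I_p2}).
Variables (E : rel T) (i : nat).

Let strong (f : T * T) := E f.1 f.2 && (i <= #|R1 f.1| * #|R2 f.2|).
Let apart (f g : T * T) := [&& f.1 != g.1, f.1 != g.2, f.2 != g.1 & f.2 != g.2].

Lemma apartC f g : apart f g = apart g f.
Proof.
rewrite /apart [g.1 == f.1]eq_sym [g.1 == f.2]eq_sym [g.2 == f.1]eq_sym [g.2 == f.2]eq_sym.
by case: (f.1 != g.1); case: (f.1 != g.2); case: (f.2 != g.1).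
Qed.

(* Z consists of the vertices of a maximal family of pairwise disjoint strong pairs;
   their rectangles R1 v x R2 w are disjoint and have at least i cells each. *)
Lemma hitting_set :
  (forall f g, strong f -> strong g -> apart f g ->
     R1 f.1 :&: R1 g.1 = set0 \/ R2 f.2 :&: R2 g.2 = set0) ->
  exists Z : {set T}, i * #|Z| <= 2 * (p1 * p2) /\
    forall f, strong f -> (f.1 \in Z) || (f.2 \in Z).
Proof.
move=> disj.
pose good (F : {set T * T}) := [forall f in F, strong f] &&
  [forall f in F, forall g in F, (f != g) ==> apart f g].
have good0 : good set0.
  by apply/andP; split; apply/forall_inP => f; rewrite inE.
have [F /andP[/forall_inP Fs /forall_inP Fa] maxF] := arg_maxnP (fun F : {set T * T} => #|F|) good0.
have {}Fa f g : f \in F -> g \in F -> f != g -> apart f g.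
  by move=> fF gF; have /forall_inP/(_ g gF)/implyP := Fa f fF; apply.
exists (fst @: F :|: snd @: F); split; last first.
  move=> f sf; rewrite -[_ || _]negbK negb_or; apply/negP => /andP[n1 n2].
  have apf g : g \in F -> apart f g.
    move=> gF; move: n1 n2; rewrite !inE !negb_or => /andP[a1 a2] /andP[a3 a4].
    apply/and4P; split; [apply: contra a1|apply: contra a2|apply: contra a3|apply: contra a4];
    by move=> /eqP ->; apply: imset_f.
  have fF : f \notin F.
    by apply/negP => /apf; rewrite /apart eqxx.
  have : good (f |: F).
    apply/andP; split; first by apply/forall_inP => g; rewrite !inE => /orP[/eqP ->|/Fs].
    apply/forall_inP => g gF; apply/forall_inP => h hF; apply/implyP => gh.
    move: gF hF; rewrite !inE => /orP[/eqP eg|gF] /orP[/eqP eh|hF].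
    - by rewrite eg eh eqxx in gh.
    - by rewrite eg; apply: apf.
    - by rewrite eh apartC; apply: apf.
    - exact: Fa.
  by move/maxF; rewrite /= cardsU1 fF add1n ltnn.
apply: leq_trans (_ : i * (2 * #|F|) <= _).
  rewrite leq_mul2l; apply/orP; right; rewrite cardsU mul2n -addnn.
  by apply: leq_trans (leq_subr _ _) _; apply: leq_add; apply: leq_imset_card.
rewrite mulnCA leq_mul2l /=.
pose rect (f : T * T) := setX (R1 f.1) (R2 f.2).
apply: leq_trans (_ : \sum_(f in F) #|rect f| <= _).
  rewrite mulnC -sum_nat_const; apply: leq_sum => f /Fs /andP[_].
  by rewrite cardsX.
rewrite (eq_bigr (fun f => \sum_(kl : 'I_p1 * 'I_p2) (kl \in rect f))); last first.
  by move=> f _; rewrite -sum1_card big_mkcond; apply: eq_bigr => kl _; case: (kl \in _).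
rewrite exchange_big /=; apply: leq_trans (_ : \sum_(kl : 'I_p1 * 'I_p2) 1 <= _); last first.
  by rewrite sum1_card card_prod !card_ord.
apply: leq_sum => kl _.
have -> : \sum_(f in F) (kl \in rect f) = #|[set f in F | kl \in rect f]|.
  by rewrite -sum1dep_card big_mkcondr; apply: eq_bigr => f _; case: (kl \in _).
apply/card_le1P => f; rewrite inE => /andP[fF kf] g.
rewrite inE [RHS]inE; apply/idP/eqP => [/andP[gF kg]|->]; last by rewrite fF kf.
apply/eqP/negPn/negP => fg; move: kf kg; rewrite !inE => /andP[f1 f2] /andP[g1 g2].
rewrite eq_sym in fg.
have [e0|e0] := disj f g (Fs f fF) (Fs g gF) (Fa f g fF gF fg).
  by have := in_set0 kl.1; rewrite -e0 inE f1 g1.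
by have := in_set0 kl.2; rewrite -e0 inE f2 g2.
Qed.

End HittingPairs.

(** * A third longest cycle *)

Section TwoCycles.
Variables (T : finType) (e : rel T) (d t : nat) (C1 C2 : seq T) (P1 P2 : {set T}).
Hypotheses (e_sym : symmetric e) (e_irr : irreflexive e) (e_reg : regular_graph e d).
Hypotheses (t1 : 1 < t) (td : 64 * t <= d) (av : avoids_separators e t).
Hypotheses (lC1 : longest e C1) (lC2 : longest e C2).
Hypotheses (b1 : based C1 C2) (b2 : based C2 C1).
Let p := hit C1 C2.
Hypotheses (tp : 6 * p <= t).
Hypotheses (hP1 : hull e d [set x in C1] P1) (hP2 : hull e d [set x in C2] P2).

Let R1 := reached_arcs e C1 C2.
Let R2 := reached_arcs e C2 C1.
Let i := arc_threshold t (size C1).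
Let W := free C1 C2.
Let A1 := [set v in W | i <= #|R1 v|].
Let A2 := [set v in W | i <= #|R2 v|].
Let E := W :\: (A1 :|: A2).
Definition near_hull (P : {set T}) := [set y | d <= 16 * deg_in e P y].

Lemma in_A1 v : (v \in A1) = (v \in W) && (i <= #|R1 v|).
Proof. by rewrite in_set. Qed.

Lemma in_A2 v : (v \in A2) = (v \in W) && (i <= #|R2 v|).
Proof. by rewrite in_set. Qed.

Lemma deg_A1 v : v \in W -> v \notin A1 -> deg_in e A1 v <= p.
Proof.
move=> vW vA; rewrite leqNgt; apply/negP => lt; move: vA; rewrite in_A1 vW /=.
move/negP; apply; apply: reached_closed => //.
apply: leq_trans lt _; apply/subset_leq_card/setIS/subsetP => u.
by rewrite in_A1 => /andP[_ hu]; rewrite in_set.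
Qed.

Lemma deg_A2 v : v \in W -> v \notin A2 -> deg_in e A2 v <= p.
Proof.
move=> vW vA; rewrite leqNgt; apply/negP => lt; move: vA; rewrite in_A2 vW /=.
move/negP; apply; apply: reached_closed => //; first by rewrite freeC.
have {}lt : hit C2 C1 < deg_in e A2 v by rewrite hitC.
apply: leq_trans lt _; apply/subset_leq_card/setIS/subsetP => u.
by rewrite in_A2 => /andP[_ hu]; rewrite in_set.
Qed.

(** A denser part of E would contain a cycle of length more than t off both cycles, and by
    [cycle_reaches_arcs] its vertices would belong to A1 or to A2. *)
Lemma E_sparse (E' : {set T}) : E' \subset E -> edges e E' E' <= 2 * t * #|E'|.
Proof.
move=> sE; have [->|E0] := eqVneq E' set0; first by rewrite /edges big_set0.
rewrite leqNgt; apply/negP => /ltnW lt.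
have [O [tO cO uO OE]] := long_cycle_dense e_sym e_irr (ltnW t1) E0 lt.
have Ofree : {in O, forall v, v \in free C1 C2}.
  by move=> v /OE/(subsetP sE); rewrite inE => /andP[].
have [o oO] : exists o, o \in O by case: (O) tO => // o s _; exists o; rewrite mem_head.
have := subsetP sE _ (OE _ oO); rewrite in_setD in_setU negb_or => /andP[/andP[n1 n2] oW].
have [/(_ o oO) h|/(_ o oO) h] :=
  cycle_reaches_arcs e_sym t1 av lC1 lC2 b1 b2 tp (ltnW tO) cO uO Ofree.
  by rewrite in_A1 oW h in n1.
by rewrite in_A2 oW h in n2.
Qed.

Lemma deg_E v : v \in E -> deg_in e A1 v <= p /\ deg_in e A2 v <= p.
Proof.
rewrite in_setD in_setU negb_or => /andP[/andP[n1 n2] vW].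
by split; [apply: deg_A1|apply: deg_A2].
Qed.

Lemma p_small : 64 * p <= d.
Proof. by move: tp td; clear; lia. Qed.

Let Y0 := E :\: (P1 :|: P2).

(** A vertex of Y0 has few neighbours in A1 and A2, and on average few in Y0 because E is sparse. So
    nearly all its neighbours lie in the hulls; but a vertex outside both hulls sends at most 3d / 4
    edges to each, so on average it must be near both. *)
Lemma card_Y0 : #|Y0| <= 6 * #|near_hull P1 :&: near_hull P2|.
Proof.
have [C1P _ hv1 _] := hP1; have [C2P _ hv2 _] := hP2.
pose QQ := near_hull P1 :&: near_hull P2.
(* Scaled by 16, each hull takes at most 12d. If y is near at most one of them the two take at most
   12d + d = 13d, otherwise at most 24d = 13d + 11d. *)
have degY y : y \in Y0 -> 16 * d <= 32 * p + 16 * deg_in e Y0 y + 13 * d + 11 * d * (y \in QQ).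
  move=> yY; have := yY; rewrite in_setD in_setU negb_or => /andP[/andP[y1 y2] yE].
  have [a1 a2] := deg_E yE; have q1 := hv1 _ y1; have q2 := hv2 _ y2.
  have : d <= deg_in e A1 y + deg_in e A2 y + deg_in e P1 y + deg_in e P2 y + deg_in e Y0 y.
    rewrite -[X in X <= _](deg_inT e_reg y).
    have sub : setT \subset A1 :|: A2 :|: P1 :|: P2 :|: Y0.
      apply/subsetP => v _; rewrite !in_setU /Y0 in_setD in_setU /E in_setD in_setU.
      case vA1 : (v \in A1) => //=; case vA2 : (v \in A2) => //=.
      case vP1 : (v \in P1) => //=; case vP2 : (v \in P2) => //=.
      rewrite in_free; apply/andP; split.
        by apply: contraFN vP1 => vC; apply: (subsetP C1P); rewrite inE.
      by apply: contraFN vP2 => vC; apply: (subsetP C2P); rewrite inE.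
    apply: leq_trans (deg_inS e y sub) _.
    do 4![apply: leq_trans (deg_inU _ _ _ _) _; rewrite leq_add2r]; exact: leqnn.
  have : 16 * (deg_in e P1 y + deg_in e P2 y) <= 13 * d + 11 * d * (y \in QQ).
    rewrite /QQ !inE.
    case: (leqP d (16 * deg_in e P1 y)); case: (leqP d (16 * deg_in e P2 y)) => /=;
    move: q1 q2; clear; lia.
  move: a1 a2; clear; lia.
have {}degY : \sum_(y in Y0) 16 * d <=
    \sum_(y in Y0) (32 * p + 16 * deg_in e Y0 y + 13 * d + 11 * d * (y \in QQ)).
  by apply: leq_sum.
have cQ : \sum_(y in Y0) (y \in QQ) <= #|QQ|.
  rewrite -sum1_card [X in _ <= X]big_mkcond [X in X <= _]big_mkcond /=.
  by apply: leq_sum => y _; case: (y \in Y0); case: (y \in QQ).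
have sp : edges e Y0 Y0 <= 2 * t * #|Y0| by apply: E_sparse; apply: subsetDl.
move: degY; rewrite !big_split /= !sum_nat_const -!big_distrr /= -/(edges e Y0 Y0).
move: cQ sp p_small td t1; rewrite -/QQ.
move: #|Y0| #|QQ| (\sum_(y in Y0) (y \in QQ)) (edges _ _ _) => a b b' c.
clear => le1 le2 le3 le4 le5 le6.
have d0 : 0 < d by lia.
rewrite -(leq_pmul2l d0).
have h1 : 2 * (a * (32 * p)) <= a * d.
  by rewrite mulnCA leq_mul2l; apply/orP; right; lia.
have h2 : 2 * (16 * (2 * t * a)) <= a * d.
  by rewrite [_ * a]mulnC !mulnA -[a * d]mulnC ![_ * a]mulnC -!mulnA; nia.
have h3 : 11 * d * b' <= d * (11 * b) by rewrite -mulnA mulnCA !leq_mul2l le1 !orbT.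
nia.
Qed.

Let Y1 := [set v in P1 :&: W | R1 v == set0].

Lemma in_Y1 v : (v \in Y1) = [&& v \in P1, v \in W & R1 v == set0].
Proof. by rewrite in_set in_setI andbA. Qed.

Lemma reached_C1 v : v \in C1 -> v \notin C2 -> R1 v != set0.
Proof.
move=> v1 v2; have [h3 cC uC] := longest_cycle lC1; have [x [s eC xC2]] := b1.
have [k vk] := arc_cover uC eC xC2 v1 v2.
by apply/set0Pn; exists k; rewrite inE; apply: reach_self.
Qed.

(** By [reached_closed] with i = 1, a vertex of Y1 has at most p neighbours that reach an arc, and
    any other neighbour in [P1 :\: Y1] lies on C2. Maximality of the hull demands many edges from Y1
    to [P1 :\: Y1], so C2 has to supply them. *)
Lemma card_Y1 : #|Y1| <= 3 * #|P1 :&: [set x in C2]|.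
Proof.
have [C1P _ _ hY] := hP1.
have YP : Y1 \subset P1 by apply/subsetP => v; rewrite in_Y1 => /andP[].
have YC : [disjoint Y1 & [set x in C1]].
  apply/pred0P => v /=; apply/negP => /andP[].
  by rewrite in_Y1 in_free => /and3P[_ /andP[/negbTE vC _] _]; rewrite inE vC.
have degY v : v \in Y1 -> deg_in e (P1 :\: Y1) v <= p + deg_in e (P1 :&: [set x in C2]) v.
  rewrite in_Y1 => /and3P[vP vW /eqP rv].
  apply: leq_trans (_ : deg_in e ([set u | 1 <= #|R1 u|] :|: P1 :&: [set x in C2]) v <= _).
    apply/deg_inS/subsetP => u; rewrite in_setD => /andP[uY uP].
    rewrite in_setU in_setI uP inE card_gt0 orbC; case uC2 : (u \in [set x in C2]) => //=.
    rewrite inE in uC2; case uC1 : (u \in C1); first by rewrite reached_C1 // uC2.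
    by apply: contra uY => ru; rewrite in_Y1 uP in_free uC1 uC2.
  apply: leq_trans (deg_inU _ _ _ _) _; rewrite leq_add2r leqNgt; apply/negP => lt.
  have := @reached_closed T e e_irr p W (fun k : 'I_p => arc_of C1 C2 k) v 1 isT vW lt.
  by rewrite -/(reached_arcs e C1 C2 v) -/(R1 v) rv cards0.
have h1 := hY _ YP YC.
have h2 : edges e Y1 (P1 :\: Y1) <= p * #|Y1| + d * #|P1 :&: [set x in C2]|.
  apply: leq_trans (_ : \sum_(v in Y1) (p + deg_in e (P1 :&: [set x in C2]) v) <= _).
    exact: leq_sum.
  rewrite big_split /= sum_nat_const mulnC leq_add2l -/(edges _ _ _) (edges_sym e_sym).
  exact: edges_le.
have h3 : edges e Y1 Y1 + edges e Y1 (P1 :\: Y1) <= d * #|Y1|.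
  by rewrite -(edges_splitr e Y1 YP); apply: edges_le.
move: h1 h2 h3 p_small td t1.
move: #|Y1| #|P1 :&: _| (edges e Y1 Y1) (edges e Y1 (P1 :\: Y1)) => a b c c'.
clear => h1 h2 h3 h4 h5 h6.
have d0 : 0 < d by lia.
rewrite -(leq_pmul2l d0).
have h7 : 64 * (p * a) <= d * a by rewrite mulnA leq_mul2r h4 orbT.
nia.
Qed.

End TwoCycles.

Section ThirdCycle.
Variables (T : finType) (e : rel T) (d t : nat) (C1 C2 : seq T) (P1 P2 : {set T}).
Hypotheses (e_sym : symmetric e) (e_irr : irreflexive e) (e_reg : regular_graph e d).
Hypotheses (t1 : 1 < t) (td : 64 * t <= d) (av : avoids_separators e t).
Hypotheses (lC1 : longest e C1) (lC2 : longest e C2).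
Hypotheses (b1 : based C1 C2) (b2 : based C2 C1).
Let p := hit C1 C2.
Hypotheses (tp : 6 * p <= t).
Hypotheses (hP1 : hull e d [set x in C1] P1) (hP2 : hull e d [set x in C2] P2).

Let R1 := reached_arcs e C1 C2.
Let R2 := reached_arcs e C2 C1.
Let i := arc_threshold t (size C1).
Let W := free C1 C2.
Let A1 := [set v in W | i <= #|R1 v|].
Let A2 := [set v in W | i <= #|R2 v|].
Let Y0 := (W :\: (A1 :|: A2)) :\: (P1 :|: P2).
Let Y1 := [set v in P1 :&: W | R1 v == set0].
Let Y2 := [set v in P2 :&: free C2 C1 | R2 v == set0].
Let near := [rel v w : T | (v == w) || e v w].

(** A common cell (k, l) would let both pairs connect arc k with arc l. The bottleneck z of these
    arcs lies in at most one of the two disjoint pairs, so the other pair connects them off z. *)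
Lemma disjoint_rectangles v w v' w' : near v w -> near v' w' ->
  [&& v != v', v != w', w != v' & w != w'] ->
  R1 v :&: R1 v' = set0 \/ R2 w :&: R2 w' = set0.
Proof.
move=> vw vw' /and4P[n1 n2 n3 n4].
have [->|/set0Pn[k]] := eqVneq (R1 v :&: R1 v') set0; first by left.
have [->|/set0Pn[l]] := eqVneq (R2 w :&: R2 w') set0; first by right.
rewrite !in_setI => /andP[lw lw'] /andP[kv kv']; exfalso.
have [z sep] := arcs_separated e_sym k l lC1 lC2.
set D := _ :\ z in sep.
have key a b : near a b -> z != a -> z != b -> k \in R1 a -> l \in R2 b -> False.
  move=> nab za zb; rewrite !in_set => ka lb.
  have [x xI ax] := reachP _ _ _ _ ka z za.
  have [y yJ bY] := reachP _ _ _ _ lb z zb.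
  apply: (negP (sep x y xI yJ)).
  have sub1 : (free C1 C2 :|: arc_of C1 C2 k) :\ z \subset D.
    by apply/setSD/subsetUl.
  have sub2 : (free C2 C1 :|: arc_of C2 C1 l) :\ z \subset D.
    rewrite freeC; apply: setSD; apply/subsetP => u; rewrite !in_setU.
    by case/orP => ->; rewrite ?orbT.
  rewrite (sym_connect_sym (rin_sym e_sym _)).
  have yb : connect (rin e D) y b.
    by rewrite (sym_connect_sym (rin_sym e_sym _)); apply: connect_rin_sub sub2 bY.
  apply: connect_trans yb _; apply: connect_trans (connect_rin_sub sub1 ax).
  case/orP: nab => [/eqP ->|eab]; first exact: connect0.
  have aD := subsetP sub1 a; have bD := subsetP sub2 b.
  apply: connect1; rewrite /rin /= [e b a]e_sym eab andbT; apply/andP; split.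
    by apply: bD; rewrite in_setD1 eq_sym zb (reach_in zb lb).
  by apply: aD; rewrite in_setD1 eq_sym za (reach_in za ka).
have [ez|zv] := eqVneq z v.
  by apply: (key v' w') => //; rewrite ez.
have [ez|zw] := eqVneq z w; last exact: (key v w).
by apply: (key v' w') => //; rewrite ez.
Qed.

Lemma third_cycle : avoids_separators e 1 ->
  exists Bad Z : {set T},
  [/\ #|Bad| <= p + 6 * #|near_hull e d P1 :&: near_hull e d P2|
        + 3 * #|P1 :&: [set x in C2]| + 3 * #|P2 :&: [set x in C1]|,
      i * #|Z| <= 2 * (p * p)
    & forall C3, longest e C3 -> (exists2 v, v \in C3 & v \in Bad :|: Z) \/
        exists v w, [/\ (v, w) \in close_pairs C3, v \in P1 & w \in P2]].
Proof.
move=> av1.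
have cY0 : #|Y0| <= 6 * #|near_hull e d P1 :&: near_hull e d P2|.
  exact: (card_Y0 e_sym e_irr e_reg t1 td av lC1 lC2 b1 b2 tp hP1 hP2).
have cY1 : #|Y1| <= 3 * #|P1 :&: [set x in C2]|.
  exact: (card_Y1 e_sym e_irr e_reg t1 td lC1 b1 tp hP1).
have tp' : 6 * hit C2 C1 <= t by rewrite hitC.
have cY2 : #|Y2| <= 3 * #|P2 :&: [set x in C1]|.
  exact: (card_Y1 e_sym e_irr e_reg t1 td lC2 b2 tp' hP2).
have [|Z [cZ hZ]] := @hitting_set T _ _ R1 R2 near i.
  move=> f g /andP[nf _] /andP[ng _] ap.
  exact: disjoint_rectangles nf ng ap.
exists (([set x in C1] :&: [set x in C2]) :|: Y0 :|: Y1 :|: Y2), Z; split.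
- have cU (A B : {set T}) : #|A :|: B| <= #|A| + #|B| by rewrite cardsU leq_subr.
  do 3![apply: leq_trans (cU _ _) _; apply: leq_add => //].
- by rewrite [X in _ <= 2 * (_ * X)](hitC C1 C2).
move=> C3 lC3; have [h3 cC3 uC3] := longest_cycle lC3.
have [/hasP[v vC vB]|/hasPn nB] :=
  boolP (has [in ([set x in C1] :&: [set x in C2]) :|: Y0 :|: Y1 :|: Y2 :|: Z] C3).
  by left; exists v.
right.
have [C1P _ _ _] := hP1; have [C2P _ _ _] := hP2.
(* A label for C1 means reaching many of its arcs, or lying in its hull and reaching at least one.
   Off the exceptional set every vertex of C3 has a label, and since C3 meets both cycles, both
   labels occur. *)
pose L1 v := (v \in A1) || (v \in P1) && (R1 v != set0).
pose L2 v := (v \in A2) || (v \in P2) && (R2 v != set0).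
have lab1 v : v \in C1 -> v \notin C2 -> L1 v.
  move=> v1 v2; rewrite /L1 (subsetP C1P) ?inE //=.
  by rewrite (reached_C1 lC1 b1 v1 v2) orbT.
have lab2 v : v \in C2 -> v \notin C1 -> L2 v.
  move=> v1 v2; rewrite /L2 (subsetP C2P) ?inE //=.
  by rewrite (reached_C1 lC2 b2 v1 v2) orbT.
have n12 v : v \in C3 -> ~~ ((v \in C1) && (v \in C2)).
  move=> /nB; apply: contra => /andP[v1 v2]; do 4![rewrite in_setU; apply/orP; left].
  by rewrite in_setI !inE v1.
have allL : all (predU L1 L2) C3.
  apply/allP => v vC; have n12v := n12 v vC; rewrite /=.
  have [v1|v1] := boolP (v \in C1); first by rewrite v1 in n12v; rewrite lab1.
  have [v2|v2] := boolP (v \in C2); first by rewrite (lab2 v) ?orbT.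
  have vW : v \in W by rewrite in_free v1.
  move: (nB v vC); rewrite /= !in_setU !negb_or => /andP[/andP[/andP[/andP[_ n0] n1] n2] _].
  move: n1; rewrite in_set in_setI vW andbT negb_and => n1.
  move: n2; rewrite in_set in_setI freeC vW andbT negb_and => n2.
  move: n0; rewrite in_setD in_setD vW andbT !in_setU negb_and !negbK /L1 /L2.
  move: n1 n2; case: (v \in P1) => //=; case: (v \in P2) => //=.
  - by move=> -> _ _; rewrite orbT.
  - by move=> -> _ _; rewrite orbT.
  - by move=> _ -> _; rewrite !orbT.
  - by move=> _ _ /orP[] ->; rewrite ?orbT.
have hasL1 : has L1 C3.
  have [v v3 v1] := longest_cycles_meet e_sym av1 lC1 lC3.
  apply/hasP; exists v => //; apply: lab1 => //.
  by have := n12 v v3; rewrite v1.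
have hasL2 : has L2 C3.
  have [v v3 v2] := longest_cycles_meet e_sym av1 lC2 lC3.
  apply/hasP; exists v => //; apply: lab2 => //.
  by have := n12 v v3; rewrite v2 andbT.
have [v [w [vw Lv Lw]]] := close_pair_switch allL hasL1 hasL2.
have so : sorted e C3.
  by case: (C3) cC3 => //= x s; rewrite rcons_path => /andP[].
have [v3 w3 evw] := close_pairs_path e_sym so vw.
have [/andP[vP wP]|nP] := boolP ((v \in P1) && (w \in P2)); first by exists v, w.
exfalso; have nvw : near v w by case: evw => [->|h]; rewrite /near /= ?eqxx ?h ?orbT.
have R1v : 0 < #|R1 v|.
  case/orP: Lv => [|/andP[_]]; last by rewrite card_gt0.
  by rewrite in_set => /andP[_]; apply: leq_trans.
have R2w : 0 < #|R2 w|.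
  case/orP: Lw => [|/andP[_]]; last by rewrite card_gt0.
  by rewrite in_set => /andP[_]; apply: leq_trans.
(* Not both labels come from hulls, so one factor is at least i, and the other is positive. *)
have st : i <= #|R1 v| * #|R2 w|.
  case/orP: Lv => [|/andP[vP _]].
    by rewrite in_set => /andP[_ le]; apply: leq_trans le _; rewrite leq_pmulr.
  case/orP: Lw => [|/andP[wP _]]; last by rewrite vP wP in nP.
  by rewrite in_set => /andP[_ le]; apply: leq_trans le _; rewrite leq_pmull.
have /orP[vZ|wZ] := hZ (v, w) ltac:(by apply/andP).
  by have := nB v v3; rewrite /= in_setU vZ orbT.
by have := nB w w3; rewrite /= in_setU wZ orbT.
Qed.

End ThirdCycle.

(** * Averaging over the automorphism group *)

(** Each function exceeds twice its mean on fewer than half of the elements, or on none; the strict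
    inequality keeps the two bad sets from covering G. *)
Lemma markov2 (I : finType) (G : {set I}) (f1 f2 : I -> nat) : G != set0 ->
  exists2 h, h \in G & #|G| * f1 h <= 2 * \sum_(g in G) f1 g /\
                       #|G| * f2 h <= 2 * \sum_(g in G) f2 g.
Proof.
move=> G0.
pose B (f : I -> nat) := [set h in G | 2 * \sum_(g in G) f g < #|G| * f h].
have cB f : 2 * #|B f| <= #|G| /\ (0 < #|B f| -> 2 * #|B f| < #|G|).
  have [->|B0] := eqVneq (B f) set0; first by rewrite cards0; split.
  suff lt : 2 * #|B f| < #|G| by split=> //; apply: ltnW.
  have le1 : #|B f| * (2 * \sum_(g in G) f g).+1 <= #|G| * \sum_(g in G) f g.
    rewrite -sum_nat_const [X in _ <= X]big_distrr /=.
    apply: leq_trans (_ : \sum_(h in B f) #|G| * f h <= _).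
      by apply: leq_sum => h; rewrite /B in_set => /andP[].
    rewrite [X in X <= _]big_mkcond [X in _ <= X]big_mkcond /=.
    by apply: leq_sum => h _; rewrite /B in_set; case: (h \in G) => //=; case: ifP.
  rewrite ltnNge; apply/negP => le2.
  have := leq_mul le2 (leqnn (\sum_(g in G) f g)).
  rewrite -card_gt0 in B0; nia.
have : ~~ (G \subset B f1 :|: B f2).
  apply/negP => /subset_leq_card; have := leq_card_setU (B f1) (B f2) => -[+ _].
  have [c1 c1'] := cB f1; have [c2 c2'] := cB f2.
  rewrite -card_gt0 in G0; lia.
case/subsetPn => h hG; rewrite !inE hG /= negb_or -!leqNgt => /andP[h1 h2].
by exists h.
Qed.

Section Average.
Variables (T : finType) (e : rel T).
Hypothesis e_vt : vertex_transitive e.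
Implicit Types (X Y P : {set T}) (g h : {perm T}).
Local Notation G := (graph_aut e).

(** Composition with an automorphism taking z to y shows that the count is the same at all points;
    summing over the points gives [#|Y|] for each g. *)
Lemma card_aut_point Y x : #|T| * #|[set g in G | g x \in Y]| = #|G| * #|Y|.
Proof.
have le y z : #|[set g in G | g y \in Y]| <= #|[set g in G | g z \in Y]|.
  have [h hG hzy] := aut_move e_vt z y.
  rewrite -(card_imset _ (mulgI h)); apply/subset_leq_card/subsetP => _ /imsetP[g + ->].
  by rewrite in_set => /andP[gG gY]; rewrite in_set groupM //= permM hzy.
have eqc y : #|[set g in G | g y \in Y]| = #|[set g in G | g x \in Y]|.
  by apply/eqP; rewrite eqn_leq !le.
have -> : #|T| * #|[set g in G | g x \in Y]| = \sum_(y : T) #|[set g in G | g y \in Y]|.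
  by rewrite -sum_nat_const; apply: eq_bigr => y _; rewrite eqc.
have -> : \sum_(y : T) #|[set g in G | g y \in Y]| = \sum_(y : T) \sum_(g in G) (g y \in Y).
  apply: eq_bigr => y _; rewrite -sum1dep_card big_mkcondr.
  by apply: eq_bigr => g _; case: (g y \in Y).
rewrite exchange_big -sum_nat_const /=; apply: eq_bigr => g _.
have -> : #|Y| = #|[set y | g y \in Y]|.
  rewrite -(card_imset [set y | g y \in Y] (@perm_inj _ g)); apply: eq_card => y.
  by rewrite -[y](permKV g) mem_imset ?inE //; apply: perm_inj.
by rewrite -sum1dep_card [RHS]big_mkcond; apply: eq_bigr => y _; case: (g y \in Y).
Qed.

Lemma card_aut_preimage Y x : #|T| * #|[set h in G | x \in h @: Y]| = #|G| * #|Y|.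
Proof.
rewrite -(card_aut_point Y x); congr (_ * _).
rewrite -(card_imset _ (@invg_inj _)); apply: eq_card => h.
rewrite -[h]invgK mem_imset; last exact: invg_inj.
rewrite in_set [RHS]in_set invgK.
have -> : (h^-1%g \in G) = (h \in G) by rewrite groupV.
congr (_ && _); rewrite -[X in X \in _ @: _](permK h) mem_imset //; exact: perm_inj.
Qed.

Lemma sum_aut_meet X Y : #|T| * \sum_(g in G) #|g @: X :&: Y| = #|G| * #|X| * #|Y|.
Proof.
rewrite (eq_bigr (fun g : {perm T} => \sum_(x in X) (g x \in Y))); last first.
  move=> g _; have -> : g @: X :&: Y = g @: [set x in X | g x \in Y].
    apply/setP => y; rewrite -[y](permKV g) in_setI !mem_imset ?inE //; exact: perm_inj.
  rewrite card_imset; last exact: perm_inj.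
  by rewrite -sum1dep_card big_mkcondr; apply: eq_bigr => x _; case: (g x \in Y).
rewrite exchange_big big_distrr /= -mulnA mulnCA -sum_nat_const.
apply: eq_bigr => x _; rewrite -(card_aut_point Y x); congr (_ * _).
by rewrite -sum1dep_card big_mkcondr; apply: eq_bigr => g _; case: (g x \in Y).
Qed.

Definition pair_count (M : seq (T * T)) P g h :=
  count (fun q => (g q.1 \in P) && (g q.2 \in h @: P)) M.

(** For fixed g, the second condition has probability [#|P| / #|T|] over h. The factors therefore
    multiply even when the entries of a pair coincide or are adjacent. *)
Lemma sum_pair_count M P :
  #|T| ^ 2 * \sum_(h in G) \sum_(g in G) pair_count M P g h = #|G| ^ 2 * size M * #|P| ^ 2.
Proof.
rewrite exchange_big /=.
elim: M => [|q M IH].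
  by rewrite muln0 mul0n big1 ?muln0 // => g _; rewrite big1.
pose a g := (g q.1 \in P : nat); pose b g h := (g q.2 \in h @: P : nat).
have split1 : \sum_(g in G) \sum_(h in G) pair_count (q :: M) P g h =
    \sum_(g in G) a g * \sum_(h in G) b g h +
    \sum_(g in G) \sum_(h in G) pair_count M P g h.
  rewrite -big_split /=; apply: eq_bigr => g _.
  rewrite big_distrr -big_split /=; apply: eq_bigr => h _.
  by rewrite /pair_count /= /a /b; case: (g q.1 \in P); case: (g q.2 \in _).
have sumb g : #|T| * \sum_(h in G) b g h = #|G| * #|P|.
  rewrite -(card_aut_preimage P (g q.2)); congr (_ * _).
  by rewrite -sum1dep_card big_mkcondr; apply: eq_bigr => h _; rewrite /b; case: (_ \in _).
have suma : #|T| * \sum_(g in G) a g = #|G| * #|P|.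
  rewrite -(card_aut_point P q.1); congr (_ * _).
  by rewrite -sum1dep_card big_mkcondr; apply: eq_bigr => g _; rewrite /a; case: (_ \in _).
have first : #|T| ^ 2 * \sum_(g in G) a g * \sum_(h in G) b g h = #|G| ^ 2 * #|P| ^ 2.
  rewrite expnS expn1 -mulnA big_distrr /=.
  rewrite (eq_bigr (fun g => a g * (#|G| * #|P|))); last first.
    by move=> g _; rewrite mulnCA sumb.
  by rewrite -big_distrl /= mulnA suma -expnMn mulnn.
by rewrite split1 mulnDr first IH /= mulnS mulnDl.
Qed.

End Average.

(** Since 50000 / 65 > 769, t n exceeds 769 c^2. If n^2 <= 60000 c^3, squaring this contradicts t^2
    < 2c. Otherwise the first term on the right is less than half of the left side, so n i <= 4 c
    q^2; inserting the bounds on i and q gives (t n)^3 <= 256 c^6. *)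
Lemma no_small_parameters (n c d t i q : nat) : 0 < c -> d <= 65 * t ->
  50 * 1000 * c ^ 2 < d * n -> t * t < 2 * c -> t ^ 3 < 16 * c * i -> n * q <= 2 * c ^ 2 ->
  n ^ 2 * i <= 30 * 1000 * c ^ 3 * i + 2 * (n * c * (q * q)) -> False.
Proof.
rewrite !expnS !expn0 !muln1 => c0 dt dn tc ti nq ni.
have n0 : 0 < n by case: n dn {nq ni} => //; rewrite muln0.
have tn : 769 * (c * c) < t * n.
  have := leq_mul dt (leqnn n); move: dn; rewrite -mulnA.
  move: (c * c) (d * n) => a b; rewrite -!mulnA; move: (t * n) => k; lia.
have [nc|nc] := leqP (n * n) (2 * (30 * 1000) * (c * (c * c))).
  have : (769 * (c * c)) * (769 * (c * c)) < (t * t) * (2 * (30 * 1000) * (c * (c * c))).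
    by apply: leq_trans (ltn_mul tn tn) _; rewrite mulnACA leq_mul2l nc orbT.
  have -> : t * t * (2 * (30 * 1000) * (c * (c * c))) =
      2 * (30 * 1000) * (t * t) * (c * (c * c)) by lia.
  have -> : 769 * (c * c) * (769 * (c * c)) = 769 * 769 * c * (c * (c * c)) by lia.
  rewrite ltn_mul2r => /andP[_]; lia.
have i0 : 0 < i by case: i ti {ni nc} => //; rewrite muln0.
have ni' : n * i <= 4 * c * (q * q).
  rewrite -(leq_pmul2l n0).
  have : 2 * (30 * 1000) * (c * (c * c)) * i <= n * n * i by rewrite leq_mul2r ltnW ?orbT.
  by move: ni; move: (30 * 1000) => k; clear; lia.
have h1 : n * (t * (t * t)) <= 64 * (c * c) * (q * q).
  have := leq_mul (leqnn n) (ltnW ti); have := leq_mul (leqnn (16 * c)) ni'; lia.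
have h2 : (n * q) * (n * q) <= 4 * (c * c * (c * c)) by have := leq_mul nq nq; lia.
have h3 : (t * n) * ((t * n) * (t * n)) <= 256 * (c * c * (c * c * (c * c))).
  have := leq_mul h1 (leqnn (n * n)); have := leq_mul (leqnn (64 * (c * c))) h2; lia.
have := ltn_mul tn (ltn_mul tn tn); move: h3; move: (t * n) => k.
have : 0 < c * c by rewrite muln_gt0 c0.
move: (c * c) => a; clear; nia.
Qed.

(** * The bound for vertex-transitive graphs *)

Section VertexTransitive.
Variables (T : finType) (e : rel T) (d : nat).
Hypotheses (e_sym : symmetric e) (e_irr : irreflexive e) (e_reg : regular_graph e d).
Hypotheses (e_conn : forall x y, connect e x y) (e_vt : vertex_transitive e).
Hypotheses (d2 : 1 < d) (T0 : 0 < #|T|).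
Implicit Types (X Y P : {set T}) (g h : {perm T}).
Local Notation G := (graph_aut e).

Lemma exists_longest : exists C, longest e C.
Proof.
have [x _] : exists x, x \in [set: T] by apply/card_gt0P; rewrite cardsT.
have T0' : [set: T] != set0 by apply/set0Pn; exists x.
have dense : 2 * 1 * #|[set: T]| <= edges e setT setT.
  have -> : edges e setT setT = d * #|[set: T]|.
    rewrite mulnC -sum_nat_const; apply: eq_bigr => y _; exact: deg_inT.
  by rewrite leq_mul2r d2 orbT.
have [O [sO cO uO _]] := long_cycle_dense e_sym e_irr (isT : 0 < 1) T0' dense.
have [C hC sC] : exists2 C, graph_cycle e C & size C = circumference e.
  by apply: circumference_attained (O) _; rewrite /graph_cycle /ucycleb sO cO.
by exists C; rewrite /longest hC sC eqxx.
Qed.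

Lemma longest_aut g C : g \in G -> longest e C -> longest e (map g C).
Proof.
move=> /graph_autP gA; rewrite /longest /graph_cycle /ucycleb size_map.
rewrite (map_inj_uniq (@perm_inj _ g)) cycle_map.
by rewrite (eq_cycle (e' := e)) // => x y /=; rewrite gA.
Qed.

Lemma zip_map2 g (s s' : seq T) :
  zip (map g s) (map g s') = map (fun q => (g q.1, g q.2)) (zip s s').
Proof. by elim: s s' => [|x s IH] [|y s'] //=; rewrite IH. Qed.

Lemma close_pairs_map g (s : seq T) :
  close_pairs (map g s) = map (fun q => (g q.1, g q.2)) (close_pairs s).
Proof. by rewrite /close_pairs !map_cat -!zip_map2 !behead_map. Qed.

Lemma set_map g (s : seq T) : [set x in map g s] = g @: [set x in s].
Proof.
apply/setP => y; rewrite inE; apply/mapP/imsetP => -[x xs ->]; exists x => //.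
  by rewrite inE.
by rewrite inE in xs.
Qed.

Lemma near_hull_aut g P : g \in G -> near_hull e d (g @: P) = g @: near_hull e d P.
Proof.
move=> gA; apply/setP => y; rewrite -[y](permKV g) mem_imset; last exact: perm_inj.
by rewrite !inE deg_in_aut.
Qed.

Lemma card_near_hull P : 0 < d -> #|near_hull e d P| <= 16 * #|P|.
Proof.
move=> d0; rewrite -(leq_pmul2l d0).
apply: leq_trans (_ : 16 * edges e (near_hull e d P) P <= _).
  rewrite mulnC -sum_nat_const [X in _ <= X]big_distrr /=.
  by apply: leq_sum => y; rewrite inE.
by rewrite (edges_sym e_sym) mulnCA leq_mul2l edges_le.
Qed.

Lemma based_rot v (C C' : seq T) : v \in C -> v \in C' -> based (rot (index v C) C) C'.
Proof. by move=> vC vC'; exists v; eexists; [apply: rot_index|]. Qed.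

Lemma set_rot k (C : seq T) : [set x in rot k C] = [set x in C].
Proof. by apply/setP => x; rewrite !inE mem_rot. Qed.

Lemma avoids_1 : avoids_separators e 1.
Proof. exact: (vt_avoids_separators (t := 1) e_sym e_irr e_conn e_reg e_vt d2). Qed.

(** C meets all its translates, while the mean size of the intersection is c^2 / n. This weak bound
    settles the case of bounded d. *)
Lemma card_le_longest C : longest e C -> #|T| <= size C ^ 2.
Proof.
move=> lC; have [h3 cC uC] := longest_cycle lC.
set cs := [set x in C].
have G0 : 0 < #|G| by apply/card_gt0P; exists 1%g; apply: group1.
rewrite -(leq_pmul2l G0) expnS expn1 mulnA.
have := sum_aut_meet e_vt cs cs; rewrite card_seq_set // => <-.
rewrite mulnC leq_mul2l; apply/orP; right; rewrite -[X in X <= _]muln1 -sum_nat_const.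
apply: leq_sum => h hG; have [v v2 v1] := longest_cycles_meet e_sym avoids_1 lC (longest_aut hG lC).
by apply/card_gt0P; exists v; rewrite in_setI -set_map !inE v1 v2.
Qed.

Section Counting.
Variables (C : seq T) (P : {set T}) (t : nat).
Hypotheses (lC : longest e C) (hP : hull e d [set x in C] P).
Hypotheses (t1 : 1 < t) (td : 64 * t <= d).
Let c := size C.
Let cs := [set x in C].
Let i := arc_threshold t c.
Let p h := #|h @: cs :&: cs|.
Let NP := near_hull e d P.
Let bad h := p h + 6 * #|h @: NP :&: NP| + 3 * #|h @: cs :&: P| + 3 * #|h @: P :&: cs|.

Lemma avoids_t : avoids_separators e t.
Proof. by apply: (vt_avoids_separators e_sym e_irr e_conn e_reg e_vt); lia. Qed.

Lemma translate_hits h : h \in G -> 6 * p h <= t ->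
  exists B Z : {set T}, [/\ #|B| <= bad h, i * #|Z| <= 2 * (p h * p h)
    & forall g, g \in G -> 0 < #|g @: cs :&: (B :|: Z)| + pair_count (close_pairs C) P g h].
Proof.
move=> hG tp; have lC' := longest_aut hG lC.
have [v v2 v1] := longest_cycles_meet e_sym avoids_1 lC lC'.
(* Arc ranks count from the head of the sequence, so both cycles are rotated to start at a common
   vertex. *)
set C1 := rot (index v C) C; set C2 := rot (index v (map h C)) (map h C).
have s1 : [set x in C1] = cs by rewrite set_rot.
have s2 : [set x in C2] = h @: cs by rewrite set_rot set_map.
have hp : hit C1 C2 = p h by rewrite /hit s1 s2 setIC.
have [|||||B [Z [cB cZ hZ]]] := @third_cycle T e d t C1 C2 P (h @: P) e_sym e_irr e_reg t1 td
    avoids_t (longest_rot _ lC) (longest_rot _ lC') _ _ _ _ _ avoids_1.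
- by apply: based_rot => //; rewrite mem_rot.
- by apply: based_rot => //; rewrite mem_rot.
- by rewrite hp.
- by rewrite s1.
- by rewrite s2; apply: hull_aut.
exists B, Z; split.
- apply: leq_trans cB _; rewrite hp s1 s2 near_hull_aut // /bad [_ :&: (h @: NP)]setIC.
  by rewrite [P :&: _]setIC.
- by move: cZ; rewrite hp size_rot.
move=> g gG; rewrite addn_gt0; have [[x xC xB]|[x [y [xy xP yP]]]] := hZ _ (longest_aut gG lC).
  apply/orP; left; apply/card_gt0P; exists x; rewrite in_setI xB andbT -set_map inE //.
apply/orP; right; rewrite /pair_count -has_count.
move: xy; rewrite close_pairs_map => /mapP[q qC [ex ey]].
by apply/hasP; exists q => //=; rewrite -ex -ey xP.
Qed.

(** The four terms have means at most 1, 6 * 48^2, 9 and 9 times c^2 / n, because P has at most 3c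
    vertices and NP at most 48c; the sum is 13843. *)
Lemma sum_bad : #|T| * \sum_(h in G) bad h <= #|G| * (14 * 1000 * c ^ 2).
Proof.
have [h3 cC uC] := longest_cycle lC.
have ccs : #|cs| = c by rewrite card_seq_set.
have [_ cP _ _] := hP; rewrite -/cs ccs in cP.
have cNP : #|NP| <= 48 * c.
  by apply: leq_trans (card_near_hull _ (ltnW d2)) _; lia.
have split_bad : \sum_(h in G) bad h = \sum_(h in G) p h + 6 * \sum_(h in G) #|h @: NP :&: NP|
    + 3 * \sum_(h in G) #|h @: cs :&: P| + 3 * \sum_(h in G) #|h @: P :&: cs|.
  by rewrite /bad 3!big_split /= !big_distrr.
have e1 := sum_aut_meet e_vt cs cs; have e2 := sum_aut_meet e_vt NP NP.
have e3 := sum_aut_meet e_vt cs P; have e4 := sum_aut_meet e_vt P cs.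
rewrite ccs -!mulnA in e1 e2 e3 e4.
have h2 : #|G| * (#|NP| * #|NP|) <= #|G| * (2304 * (c * c)).
  by rewrite leq_mul2l (leq_trans (leq_mul cNP cNP)) ?orbT // mulnACA.
have h3' : #|G| * (c * #|P|) <= #|G| * (3 * (c * c)).
  by rewrite leq_mul2l mulnCA leq_mul2l cP !orbT.
have h4 : #|G| * (#|P| * c) <= #|G| * (3 * (c * c)) by rewrite [#|P| * c]mulnC.
rewrite {}split_bad /p expnS expn1; move: h2 h3' h4 e1 e2 e3 e4.
move: (\sum_(g in G) #|g @: cs :&: cs|) (\sum_(g in G) #|g @: NP :&: NP|).
move: (\sum_(g in G) #|g @: cs :&: P|) (\sum_(g in G) #|g @: P :&: cs|).
by move: (#|G|) (#|NP|) (#|P|) c #|T|; clear; lia.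
Qed.

Lemma sum_pairs :
  #|T| ^ 2 * \sum_(h in G) \sum_(g in G) pair_count (close_pairs C) P g h
    <= #|G| ^ 2 * (27 * c ^ 3).
Proof.
have [h3 cC uC] := longest_cycle lC.
have ccs : #|cs| = c by rewrite card_seq_set.
have [_ cP _ _] := hP; rewrite -/cs ccs in cP.
rewrite (sum_pair_count e_vt) -mulnA leq_mul2l; apply/orP; right.
apply: leq_trans (leq_mul (size_close_pairs C) (leq_mul cP cP)) _.
by rewrite -/c !expnS expn0 muln1; lia.
Qed.

Lemma sum_hits h (S : {set T}) :
  #|T| * \sum_(g in G) #|g @: cs :&: S| = #|G| * c * #|S|.
Proof.
have [h3 cC uC] := longest_cycle lC.
by rewrite (sum_aut_meet e_vt) card_seq_set.
Qed.

Lemma sum_p : #|T| * \sum_(h in G) p h = #|G| * c ^ 2.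
Proof.
have [h3 cC uC] := longest_cycle lC.
by rewrite (sum_aut_meet e_vt) card_seq_set // -/c -mulnA mulnn.
Qed.

(* With mu = c^2 / n the mean of p, a random translate with p <= 2 mu makes every
   third translate meet the bad set, the hitting set or a pair of hulls. *)
Lemma counting_bound : 12 * c ^ 2 <= t * #|T| ->
  exists q, #|T| * q <= 2 * c ^ 2 /\
    #|T| ^ 2 * i <= 30 * 1000 * c ^ 3 * i + 2 * (#|T| * c * (q * q)).
Proof.
move=> tc.
have G0 : 0 < #|G| by apply/card_gt0P; exists 1%g; apply: group1.
have G0' : G != set0 by rewrite -card_gt0.
pose pairs h := \sum_(g in G) pair_count (close_pairs C) P g h.
(* Scaled by n, this is the number of hits on an exceptional set of size [bad h], summed over g,
   plus the number of hull pairs. Joining the two leaves only two functions for [markov2]. *)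
pose tot h := #|G| * c * bad h + #|T| * pairs h.
have [h hG [hp htot]] := markov2 p tot G0'.
have np : #|T| * p h <= 2 * c ^ 2.
  rewrite -(leq_pmul2l G0) mulnCA; apply: leq_trans (leq_mul (leqnn _) hp) _.
  by rewrite mulnCA sum_p mulnCA.
have tp : 6 * p h <= t.
  rewrite -(leq_pmul2l T0) mulnCA; apply: leq_trans (leq_mul (leqnn 6) np) _.
  by rewrite mulnA [#|T| * t]mulnC.
have [B [Z [cB cZ hits]]] := translate_hits hG tp.
(* Twice the mean costs 2 * (14000 + 27) = 28054, rounded up to 30000. *)
have ntot : #|T| * tot h <= 30 * 1000 * c ^ 3 * #|G|.
  have : #|T| ^ 2 * (#|G| * tot h) <= #|T| * (30 * 1000 * c ^ 3 * #|G| * #|G|).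
    apply: leq_trans (leq_mul (leqnn _) htot) _.
    have -> : #|T| ^ 2 * (2 * \sum_(g in G) tot g) =
       2 * (#|T| * (#|G| * c * (#|T| * \sum_(g in G) bad g))
       + #|T| * (#|T| ^ 2 * \sum_(g in G) pairs g)).
      rewrite /tot big_split /= -!big_distrr /=; lia.
    have b1 := sum_bad; have b2 := sum_pairs.
    apply: leq_trans (_ : 2 * (#|T| * (#|G| * c * (#|G| * (14 * 1000 * c ^ 2))) +
        #|T| * (#|G| ^ 2 * (27 * c ^ 3))) <= _).
      by rewrite leq_mul2l; apply: leq_add; apply: leq_mul => //; apply: leq_mul.
    by rewrite !expnS !expn0 !muln1; lia.
  by rewrite expnS expn1 -mulnA leq_pmul2l // mulnCA mulnC leq_pmul2r.
exists (p h); split=> //.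
(* Every g scores at least one hit; the hits are summed over g. *)
have le1 : #|T| * #|G| <= tot h + #|G| * c * #|Z|.
  have : #|T| * \sum_(g in G) 1 <= #|T| * \sum_(g in G)
      (#|g @: cs :&: B| + #|g @: cs :&: Z| + pair_count (close_pairs C) P g h).
    rewrite leq_mul2l; apply/orP; right; apply: leq_sum => g gG; have := hits g gG.
    rewrite setIUr => lt; apply: leq_trans lt _; rewrite leq_add2r cardsU leq_subr //.
  rewrite sum1_card !big_split /= !mulnDr !(sum_hits h) => le; apply: leq_trans le _.
  by rewrite /tot /pairs addnAC !leq_add2r leq_mul2l cB orbT.
have : #|T| * (#|T| * #|G|) * i <= (30 * 1000 * c ^ 3 * #|G| + #|T| * (#|G| * c * #|Z|)) * i.
  rewrite leq_mul2r; apply/orP; right; apply: leq_trans (leq_mul (leqnn _) le1) _.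
  by rewrite mulnDr leq_add2r.
move: G0 cZ; move: (p h) (#|Z|) (#|T|) (#|G|) => q z n g; rewrite -/c.
move: i (30 * 1000 * c ^ 3) => k a; clear; rewrite expnS expn1 => g0 cZ le2.
rewrite -(leq_pmul2l g0); apply: leq_trans (_ : n * (n * g) * k <= _); first by lia.
apply: leq_trans le2 _; have := leq_mul (leqnn (n * g * c)) cZ; lia.
Qed.

End Counting.

Lemma degree_le_card : d <= #|T|.
Proof. by have [x _] := card_gt0P T0; rewrite -(e_reg x) max_card. Qed.

Lemma edges_complement (S : {set T}) : d * #|T| <= edges e (~: S) (~: S) + 2 * (d * #|S|).
Proof.
have tot X : edges e X setT = d * #|X|.
  rewrite mulnC -sum_nat_const; apply: eq_bigr => x _; exact: deg_inT.
have := tot (~: S); rewrite (edges_splitr e _ (subsetT S)) setTD edges_sym //.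
have := edges_le e_reg S (~: S); have := cardsC S; lia.
Qed.

(** With at most a quarter of the vertices on C, at least half of the edges survive off C. They
    yield a cycle of length more than t disjoint from C, to which [disjoint_cycle_bound] applies. *)
Lemma longest_lower_bound C t : longest e C -> 1 < t -> 64 * t <= d -> 4 * size C <= #|T| ->
  t * t < 2 * size C.
Proof.
move=> lC t1 td cn; have [h3 cC uC] := longest_cycle lC.
set H := ~: [set x in C].
have cH : #|H| + size C = #|T| by rewrite -(card_seq_set uC) addnC cardsC.
have H0 : H != set0 by rewrite -card_gt0; lia.
have dH : 2 * t * #|H| <= edges e H H.
  have := edges_complement [set x in C]; rewrite -/H card_seq_set //.
  have : d * (4 * size C) <= d * #|T| by rewrite leq_mul2l cn orbT.
  have : 64 * t * #|T| <= d * #|T| by rewrite leq_mul2r td orbT.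
  have : t * #|H| <= t * #|T| by rewrite leq_mul2l max_card orbT.
  lia.
have [O [tO cO uO OH]] := long_cycle_dense e_sym e_irr (ltnW t1) H0 dH.
have av : avoids_separators e t.
  by apply: (vt_avoids_separators e_sym e_irr e_conn e_reg e_vt); lia.
have := disjoint_cycle_bound e_sym av lC t1 (ltnW tO) cO uO.
have dO : {in O, forall v, v \notin C} by move=> v /OH; rewrite !inE.
move=> /(_ dO); have : t * t <= t * (size O + 4) by rewrite leq_mul2l; lia.
lia.
Qed.

Theorem longest_cycle_bound : d * #|T| <= 50 * 1000 * circumference e ^ 2.
Proof.
have [C lC] := exists_longest.
have -> : circumference e = size C by case/andP: lC => _ /eqP ->.
have [h3 cC uC] := longest_cycle lC; set c := size C in h3 *.
rewrite leqNgt; apply/negP => dn.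
have nc := card_le_longest lC.
have dn_n := degree_le_card.
have c0 : 0 < c * c by rewrite muln_gt0; lia.
(* For smaller d the bound n <= c^2 already suffices. A large d makes t = d / 64 greater than 1 and
   absorbs the rounding in d <= 65 t. *)
have d_big : 50 * 1000 < d.
  rewrite ltnNge; apply/negP => dle; have := leq_mul dle nc; rewrite -/c; lia.
pose t := d %/ 64.
have td : 64 * t <= d by rewrite /t mulnC leq_trunc_div.
have dt : d <= 65 * t by rewrite /t; lia.
have t1 : 1 < t by rewrite /t; lia.
have cn : 4 * c <= #|T|.
  rewrite leqNgt; apply/negP => lt.
  have := leq_trans dn (leq_mul dn_n (leqnn _)); have := ltn_mul lt lt.
  move: c0; rewrite expnS expn1; lia.
have [P hP] := hull_exists e_sym e_irr e_reg [set x in C] (ltnW d2).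
have tn : 12 * c ^ 2 <= t * #|T|.
  have := leq_trans dn (leq_mul dt (leqnn _)); rewrite -mulnA; lia.
have [q [nq ni]] := counting_bound lC hP t1 td tn.
apply: (no_small_parameters _ dt dn _ _ nq ni); first by lia.
  exact: longest_lower_bound lC t1 td cn.
by rewrite mulnC -ltn_divLR ?ltnSn //; lia.
Qed.

End VertexTransitive.

Unset Implicit Arguments.
Import Order.TTheory GRing.Theory Num.Theory.
Local Open Scope ring_scope.

Theorem theorem9p3 (R : realType) :
  exists2 gamma : R, 0 < gamma &
    forall (d : nat) (T : finType) (e : rel T),
      (2 <= d)%N ->
      simple_graph e -> connected_graph e -> regular_graph e d ->
      vertex_transitive e ->
      gamma * Num.sqrt ((d * #|T|)%:R) <= (circumference e)%:R.
Proof.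
(* 224^2 = 50176 exceeds the constant 50000 of [longest_cycle_bound]. *)
exists (224%:R^-1); first by rewrite invr_gt0 ltr0n.
move=> d T e d2 [e_sym e_irr] [T0 e_conn] e_reg e_vt.
rewrite ler_pdivrMl ?ltr0n // -[leRHS]ger0_norm ?mulr_ge0 ?ler0n // -sqrtr_sqr.
apply: ler_wsqrtr; rewrite -natrM -natrX ler_nat.
apply: leq_trans (longest_cycle_bound e_sym e_irr e_reg e_conn e_vt d2 T0) _.
by rewrite expnMn leq_mul2r [(224 ^ 2)%N]expnS expn1; apply/orP; right; lia.
Qed.
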